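(* Let $\pi$ be an order-$q$-subplane of $\mathrm{PG}(2,q^3)$ exterior to $\ell_\infty$, with exterior splash $\mathbb S$, conic cover $\mathbb C$, and tangent cover $\mathbb T$. 1. A $\pi$-pencil-subline of $\mathbb S$ corresponds to a 2-regulus that meets each plane of $\mathbb T$ in a distinct line. Conversely, a 2-regulus contained in $\mathbb S$ that meets some plane of $\mathbb T$ in a line corresponds to a $\pi$-pencil-subline of $\mathbb S$. 2. A $\pi$-pencil-subline of $\mathbb S$ corresponds to a 2-regulus that meets each plane of $\mathbb C$ in a conic. Conversely, a 2-regulus contained in $\mathbb S$ that meets some plane of $\mathbb C$ in a conic corresponds to a $\pi$-pencil-subline of $\mathbb S$. 3. A $\pi$-dual-conic-subline of $\mathbb S$ corresponds to a 2-regulus that meets each plane of $\mathbb T$ in a conic. Conversely, a 2-regulus contained in $\mathbb S$ that meets some plane of $\mathbb T$ in a conic corresponds to a $\pi$-dual-conic-subline of $\mathbb S$. 4. A $\pi$-dual-conic-subline of $\mathbb S$ corresponds to a 2-regulus that meets each plane of $\mathbb C$ in a distinct line. Conversely, a 2-regulus contained in $\mathbb S$ that meets some plane of $\mathbb C$ in a line corresponds to a $\pi$-dual-conic-subline of $\mathbb S$.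
   Context: Let $q$ be a prime power, $\tau$ a primitive element of $\mathbb F_{q^3}$, and for $\alpha=a_0+a_1\tau+a_2\tau^2$ ($a_i\in\mathbb F_q$) write $[\alpha]=(a_0,a_1,a_2)$. Bruck-Bose correspondence: $\ell_\infty$ is the line $z=0$ of $\mathrm{PG}(2,q^3)$ and $\Sigma_\infty\cong\mathrm{PG}(5,q)$ is the hyperplane $z=0$ of $\mathrm{PG}(6,q)$, which has coordinates $(x_0,x_1,x_2,y_0,y_1,y_2,z)$. The affine point $(\alpha,\beta,1)$ corresponds to $([\alpha],[\beta],1)$. The point $L=(\alpha,\beta,0)$ of $\ell_\infty$ corresponds to the plane $[L]=\{([\alpha x],[\beta x],0): x\in\mathbb F_{q^3}\setminus\{0\}\}$. The planes $[L]$ form a regular 2-spread $\mathcal S$ of $\Sigma_\infty$. Order-$q$-subplanes of $\mathrm{PG}(2,q^3)$ are the images of $\mathrm{PG}(2,q)$ under $\mathrm{PGL}(3,q^3)$; order-$q$-sublines are lines of such subplanes, i.e. on $\ell_\infty$ the images of $\mathrm{PG}(1,q)$ under $\mathrm{PGL}(2,q^3)$. If $\pi$ is exterior to $\ell_\infty$ (no points on $\ell_\infty$), its exterior splash $\mathbb S$ is the set of $q^2+q+1$ points of $\ell_\infty$ on extended lines of $\pi$, and also the corresponding set of planes of $\mathcal S$. A 2-regulus is a set of $q+1$ mutually disjoint planes such that a line meeting three of them meets all. The map $b\mapsto[b]=\{[L]:L\in b\}$ is a bijection between order-$q$-sublines of $\ell_\infty$ and 2-reguli contained in $\mathcal S$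 (known). Covers: by a result of Bruck there are two sets of $q^2+q+1$ planes of $\Sigma_\infty$, the covers of $\mathbb S$. Planes in the same set are disjoint, $\mathbb S$ and both covers have the same union of points, and planes from different sets meet in exactly one point. They are named relative to $\pi$ as follows. Let $\mathscr B$ be the order-$q$-subplane that is the image of $\mathrm{PG}(2,q)$ under the homography with matrix (acting on column vectors) $$K=\begin{pmatrix}-\tau&1&0\\-\tau^q&1&0\\\tau\tau^q&-\tau-\tau^q&1\end{pmatrix}.$$ It is exterior to $\ell_\infty$, with splash $\{(k,1,0):k\in\mathscr K\}$, $\mathscr K=\{k\in\mathbb F_{q^3}: k^{q^2+q+1}=1\}$. Its tangent cover consists of the planes $[T_k]=\{([kx],[x^q],0):x\in\mathbb F_{q^3}\setminus\{0\}\}$, $k\in\mathscr K$, and its conic cover of the planes $[C_k]=\{([kx],[x^{q^2}],0):x\in\mathbb F_{q^3}\setminus\{0\}\}$, $k\in\mathscr K$. For a general exterior $\pi$, there is a homography $\phi:(x,y,z)\mapsto(ax+by+ez,\,cx+dy+fz,\,z)$ of $\mathrm{PG}(2,q^3)$ fixing $\ell_\infty$ with $\phi(\mathscr B)=\pi$. The tangent cover $\mathbb T$ and conic cover $\mathbb C$ of $\pi$ are the images of those of $\mathscr B$ under the induced map $([x],[y],0)\mapsto([ax+by],[cx+dy],0)$ of $\Sigma_\infty$ (for one, equivalently any, such $\phi$). Sublines of $\mathbb S$: if $A$ is a point of $\pi$, the $q+1$ (extended) lines of $\pi$ through $A$ meet $\ell_\infty$ in an order-$q$-subline of $\mathbb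 S$, called a $\pi$-pencil-subline of $\mathbb S$. Let $m,n$ be the two conjugates of $\ell_\infty$ with respect to $\pi$ (its images under the two nontrivial collineations in the order-3 collineation group of $\mathrm{PG}(2,q^3)$ fixing $\pi$ pointwise). A $(\pi,\ell_\infty)$-special dual conic is a (non-degenerate) dual conic of $\pi$ whose extension to $\mathrm{PG}(2,q^3)$ contains the three lines $\ell_\infty,m,n$. The $q+1$ lines of $\pi$ in such a dual conic meet $\ell_\infty$ in an order-$q$-subline of $\mathbb S$, called a $\pi$-dual-conic-subline of $\mathbb S$. The paper works with the standing (cited) description that the order-$q$-sublines contained in $\mathbb S$ are exactly $2(q^2+q+1)$ in number and fall into these two families of size $q^2+q+1$ each. A plane $\alpha$ that meets the planes of a 2-regulus $\mathcal R$ in a set of $q+1$ points meets it in either a line or a (non-degenerate) conic of $\alpha$; this is abbreviated ''$\mathcal R$ meets $\alpha$ in a line'' or ''in a conic''.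
   Formalization: The converse halves of parts 2 and 3 are stated for q > 2 only: for q = 2 any three planes of the splash form a 2-regulus, so 28 of them meet a given cover plane in a conic while each family has only 7 sublines; everything else is for all q. *)

(* Defs.v *)
From HB Require Import structures.
From mathcomp Require Import all_boot all_order all_algebra all_field.

Set Implicit Arguments.
Unset Strict Implicit.
Unset Printing Implicit Defensive.

Import GRing.Theory.
Local Open Scope ring_scope.

(* F_q is an arbitrary finite field F, F_{q^3} is a finite field L with
   #|L| = #|F| ^ 3, and iota is an embedding of F into L.  The subspaces of
   PG(n, K) are the vector subspaces of 'cV[K]_n.+1: points, lines and planes
   have vector dimension 1, 2 and 3, and incidence is inclusion. *)

(* Over a finite field there are finitely many subspaces, so that sets of
   points, lines or planes can be finite sets. *)
Section VspaceFinite.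
Import VectorInternalTheory.
HB.instance Definition _ (K : finFieldType) (vT : vectType K) :=
  [Countable of {vspace vT} by <:].
HB.instance Definition _ (K : finFieldType) (vT : vectType K) :=
  [Finite of {vspace vT} by <:].
End VspaceFinite.

Notation subspace K n := {vspace 'cV[K]_n}.

Section Projective.
Variables (K : finFieldType) (n : nat).
Implicit Types (U X : subspace K n) (R : {set subspace K n}).

Definition points_of U : {set subspace K n} :=
  [set P : subspace K n | (\dim P == 1%N) && (P <= U)%VS].

Definition homography (A : 'M[K]_n) U : subspace K n :=
  (linfun (mulmx A) @: U)%VS.

Definition is_2regulus (S : subspace K n) R : Prop :=
  [/\ #|R| = #|K|.+1,
      forall X, X \in R -> \dim X = 3 /\ (X <= S)%VS,
      forall X Y, X \in R -> Y \in R -> X != Y -> (X :&: Y)%VS = 0%VS &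
      forall l : subspace K n, \dim l = 2 -> (l <= S)%VS ->
      forall X Y Z, X \in R -> Y \in R -> Z \in R ->
        uniq [:: X; Y; Z] ->
        (l :&: X)%VS != 0%VS -> (l :&: Y)%VS != 0%VS ->
        (l :&: Z)%VS != 0%VS ->
      forall W, W \in R -> (l :&: W)%VS != 0%VS].

Definition section R X : {set subspace K n} :=
  [set P in points_of X | [exists Y in R, (P <= Y)%VS]].

End Projective.

Definition infinity (K : fieldType) (n : nat) : {vspace 'cV[K]_n.+1} :=
  lker (linfun (row ord_max : 'cV[K]_n.+1 -> 'rV[K]_1)).

(* Ternary quadratic forms, given by a (not necessarily symmetric, so that the
   characteristic may be 2) matrix. *)
Definition qform (R : comNzRingType) (Q : 'M[R]_3) (u : 'cV[R]_3) : R :=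
  (u^T *m Q *m u) 0 0.

(* The curve Q = 0 has no singular point: Q + Q^T is the matrix of the polar
   form of Q, so that (Q + Q^T) w is the gradient of Q at w.  As finite fields
   are perfect, it is enough to look at the points over the field itself. *)
Definition nondegenerate (K : fieldType) (Q : 'M[K]_3) : Prop :=
  forall w : 'cV[K]_3, w != 0 -> (Q + Q^T) *m w = 0 -> qform Q w != 0.

(* In a plane X, M gives homogeneous coordinates on X. *)
Definition is_conic_of (K : finFieldType) (n : nat)
    (X : subspace K n) (C : {set subspace K n}) : Prop :=
  exists (M : 'M[K]_(n, 3)) (Q : 'M[K]_3),
    [/\ \dim X = 3,
        (linfun (mulmx M : 'cV[K]_3 -> 'cV[K]_n) @: fullv)%VS = X,
        nondegenerate Q &
        C = [set <[M *m v]>%VS | v : 'cV[K]_3 & (v != 0) && (qform Q v == 0)]].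

Definition meets_in_the_line (K : finFieldType) (n : nat)
    (R : {set subspace K n}) (X l : subspace K n) : Prop :=
  [/\ \dim l = 2, (l <= X)%VS & section R X = points_of l].

Definition meets_in_a_line (K : finFieldType) (n : nat)
    (R : {set subspace K n}) (X : subspace K n) : Prop :=
  exists l, meets_in_the_line R X l.

Definition meets_in_a_conic (K : finFieldType) (n : nat)
    (R : {set subspace K n}) (X : subspace K n) : Prop :=
  is_conic_of X (section R X).

Notation ell_inf L := (infinity L 2).
Notation Sigma_inf F := (infinity F 6).

Section Subplanes.
Variables (F L : finFieldType) (iota : {rmorphism F -> L}).
Implicit Types (pi b : {set subspace L 3}).

Definition PG2 : {set subspace L 3} :=
  [set <[map_mx iota v]>%VS | v : 'cV[F]_3 & v != 0].

Definition subplane_of (A : 'M[L]_3) : {set subspace L 3} :=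
  [set homography A P | P in PG2].

Definition is_subplane pi : Prop :=
  exists2 A : 'M[L]_3, A \in unitmx & pi = subplane_of A.

Definition exterior pi : Prop :=
  forall P, P \in pi -> ~~ (P <= ell_inf L)%VS.

(* The lines of pi, extended to lines of PG(2, q^3). *)
Definition lines_of pi : {set subspace L 3} :=
  [set (PQ.1 + PQ.2)%VS | PQ in setX pi pi & PQ.1 != PQ.2].

Definition meet_ell_inf (ls : {set subspace L 3}) : {set subspace L 3} :=
  [set (l :&: ell_inf L)%VS | l in ls].

Definition splash pi : {set subspace L 3} := meet_ell_inf (lines_of pi).

Definition pencil_subline pi b : Prop :=
  exists2 A, A \in pi & b = meet_ell_inf [set l in lines_of pi | (A <= l)%VS].

(* Collineations of PG(2, q^3), as semilinear maps v |-> M v^sigma.  The set of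
   images of the vectors of U is already a subspace, sigma being bijective. *)
Definition collineation (sigma : {rmorphism L -> L}) (M : 'M[L]_3)
    (U : subspace L 3) : subspace L 3 :=
  <<[seq (M *m map_mx sigma v)%R | v : 'cV[L]_3 in U]>>%VS.

Definition conjugate_line pi (l m : subspace L 3) : Prop :=
  exists (sigma : {rmorphism L -> L}) (M : 'M[L]_3),
    [/\ M \in unitmx,
        forall P, P \in pi -> collineation sigma M P = P,
        exists P : subspace L 3, \dim P = 1%N /\ collineation sigma M P <> P &
        m = collineation sigma M l].

Definition line_with_coords (u : 'cV[L]_3) : subspace L 3 :=
  lker (linfun (mulmx u^T : 'cV[L]_3 -> 'cV[L]_1)).

(* The set of lines of PG(2, q^3) whose coordinates, in the frame in which
   subplane_of A is PG(2, q), are zeros of the quadratic form Q over F_q: the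
   extension to PG(2, q^3) of a dual conic of subplane_of A. *)
Definition extended_dual_conic (A : 'M[L]_3) (Q : 'M[F]_3) :
    {set subspace L 3} :=
  [set homography A (line_with_coords u)
     | u : 'cV[L]_3 & (u != 0) && (qform (map_mx iota Q) u == 0)].

Definition special_dual_conic pi (D : {set subspace L 3}) : Prop :=
  exists (A : 'M[L]_3) (Q : 'M[F]_3),
    [/\ A \in unitmx /\ pi = subplane_of A,
        nondegenerate Q,
        D = extended_dual_conic A Q,
        ell_inf L \in D &
        forall m, conjugate_line pi (ell_inf L) m -> m \in D].

Definition dual_conic_subline pi b : Prop :=
  exists2 D, special_dual_conic pi D & b = meet_ell_inf (D :&: lines_of pi).

End Subplanes.

Section BruckBose.
Variables (F L : finFieldType) (iota : {rmorphism F -> L}) (tau : L).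
Implicit Types (pi : {set subspace L 3}) (X : subspace F 7).

(* [alpha]; the default value 0 is not used when tau is a primitive element *)
Definition coords (alpha : L) : 'cV[F]_3 :=
  odflt 0 [pick a : 'cV[F]_3
            | alpha == \sum_(i < 3) iota (a i 0) * tau ^+ i].

(* ([x], [y], 0) *)
Definition bb (x y : L) : 'cV[F]_7 :=
  col_mx (col_mx (coords x) (coords y)) (0 : 'cV[F]_1).

(* In the next three definitions the listed vectors, together with 0, already
   form an F_q-subspace, so that taking the span adds no point. *)
Definition bb_plane (P : subspace L 3) : subspace F 7 :=
  <<[seq bb (v 0%R 0%R) (v 1%R 0%R) | v : 'cV[L]_3 in P]>>%VS.

Definition cover_plane (r : nat) (k : L) : subspace F 7 :=
  <<[seq bb (k * x)%R (x ^+ (#|F| ^ r)%N)%R | x : L]>>%VS.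

Definition induced_map (a b c d : L) X : subspace F 7 :=
  <<[seq bb (a * v.1 + b * v.2)%R (c * v.1 + d * v.2)%R
      | v : L * L in [pred v : L * L | bb v.1 v.2 \in X]]>>%VS.

Definition bb_image (b : {set subspace L 3}) : {set subspace F 7} :=
  [set bb_plane P | P in b].

Definition splash_planes pi : {set subspace F 7} := bb_image (splash pi).

Definition mx3 (rows : seq (seq L)) : 'M[L]_3 :=
  \matrix_(i < 3, j < 3) nth 0 (nth [::] rows i) j.

Definition Kmx : 'M[L]_3 :=
  let q := #|F| in
  mx3 [:: [:: - tau         ; 1                ; 0];
          [:: - (tau ^+ q)  ; 1                ; 0];
          [:: tau * tau ^+ q; - tau - tau ^+ q ; 1]].

Definition subplaneB : {set subspace L 3} := subplane_of iota Kmx.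

Definition norm1 : {set L} := [set k | k ^+ (#|F| ^ 2 + #|F| + 1)%N == 1].

Definition tangent_coverB : {set subspace F 7} :=
  [set cover_plane 1 k | k in norm1].
Definition conic_coverB : {set subspace F 7} :=
  [set cover_plane 2 k | k in norm1].

Definition is_transported_cover (coverB : {set subspace F 7}) pi
    (cover : {set subspace F 7}) : Prop :=
  exists a b c d e f : L,
    let phi := mx3 [:: [:: a; b; e]; [:: c; d; f]; [:: 0; 0; 1]] in
    [/\ phi \in unitmx,
        [set homography phi P | P in subplaneB] = pi &
        cover = [set induced_map a b c d X | X in coverB]].

Definition is_tangent_cover := is_transported_cover tangent_coverB.
Definition is_conic_cover := is_transported_cover conic_coverB.

End BruckBose.

Definition meets_each_in_a_distinct_line (F : finFieldType)
    (R cover : {set subspace F 7}) : Prop :=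
  (forall X, X \in cover -> meets_in_a_line R X) /\
  (forall X Y l, X \in cover -> Y \in cover ->
     meets_in_the_line R X l -> meets_in_the_line R Y l -> X = Y).

Definition meets_each_in_a_conic (F : finFieldType)
    (R cover : {set subspace F 7}) : Prop :=
  forall X, X \in cover -> meets_in_a_conic R X.

(* Main.v *)
From HB Require Import structures.
From mathcomp Require Import all_boot all_order all_algebra all_field.
From mathcomp Require Import ring.
Require Import Defs.

Set Implicit Arguments.
Unset Strict Implicit.
Unset Printing Implicit Defensive.

Import GRing.Theory.
Local Open Scope ring_scope.

(** Over F the field L is a space of dimension 3, whose nonzero elements s
    stand for the lines of pi: the line with coordinates u stands for
    s = u0 + u1 tau + u2 tau^2. In the frame of pi the line at infinity joins
    (1, tau, tau^2) to its conjugate, and therefore the line s meets it in a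
    point that, in suitable coordinates, is (s, s^q). So the splash consists of
    the points (s, s^q), with spread planes {(s x, s^q x)}.

    The lines of pi through a point are the s in an F-subspace W of L of
    dimension 2 ([pencil_sublineP]). A quadratic form over F on the lines is a
    trace Tr (al s^2 + be s s^q), and it vanishes at the line at infinity
    exactly when al = 0. As s s^q is, up to a factor in F, a conjugate of
    1 / s, the lines of a special dual conic are the s with 1 / s in some W
    ([dual_conic_sublineP]). Exchanging the two coordinates turns (s, s^q)
    into the point of 1 / s. So it exchanges the two families of sublines, and
    it also exchanges the covers ([cover_swap1], [cover_swap2]). Half of the
    assertions thus give the other half ([family_meets_covers]).

    By Hilbert 90 the element k of a cover plane is m^(q-1), and the tangent
    cover plane {(k x, x^q)} meets the spread plane of s where x is an
    F-multiple of m s. As s runs over W this is a line, and a section that is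
    a line can only come from such a W. On the conic cover plane
    {(k x, x^(q^2))}, where k = m^(q^2-1), the point has x = m s s^(q^2), a
    quadratic function of s; its coefficients on W are independent and the
    points form a conic ([pencil_meets_conic]).

    It remains to see that, for q > 2, a 2-regulus contained in the splash
    comes from one of the families ([regulus_in_spread_types]); a regulus of
    the wrong family would give a section that is both a line and a conic.
    Three planes of the regulus put it in the form of the points
    (a al + b be, a ga + b de) with a, b in F. All of them being of the form
    (s, s^q) up to a factor, their two coordinates have the same norm. Two
    cubic polynomials thus agree at more than 2 elements of F and have the same
    leading coefficient; so they are equal, be / al is a conjugate of de / ga,
    and the two conjugates other than de / ga itself give the two families. *)

(** * The cubic extension and its Frobenius map *)

(** The embedding is an argument only so that the map can be declared to be a
    ring morphism: additivity holds because L has the characteristic of F. *)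
Definition frob (F L : finFieldType) (iota : {rmorphism F -> L}) (x : L) : L :=
  x ^+ #|F|.

Section FrobeniusMorphism.
Variables (F L : finFieldType) (iota : {rmorphism F -> L}).

Lemma frob_is_zmod_morphism : zmod_morphism (frob iota).
Proof.
have [p p_pr pF] := finPcharP F.
have pL : p \in [pchar L] by rewrite (fmorph_pchar iota).
have qL : [pchar L].-nat #|F|.
  rewrite (eq_pnat _ (pcharf_eq pL)) -cardsT.
  by have /and3P[] := abelian.fin_ring_pchar_abelem pF.
by move=> x y; rewrite /frob exprDn_pchar // exprNn_pchar.
Qed.

Lemma frob_is_monoid_morphism : monoid_morphism (frob iota).
Proof. by split=> [|x y]; rewrite /frob ?expr1n ?exprMn. Qed.

HB.instance Definition _ :=
  GRing.isZmodMorphism.Build L L (frob iota) frob_is_zmod_morphism.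
HB.instance Definition _ :=
  GRing.isMonoidMorphism.Build L L (frob iota) frob_is_monoid_morphism.

Lemma frobM x y : frob iota (x * y) = frob iota x * frob iota y.
Proof. exact: rmorphM. Qed.

Lemma frobD x y : frob iota (x + y) = frob iota x + frob iota y.
Proof. exact: rmorphD. Qed.

Lemma frobV x : frob iota x^-1 = (frob iota x)^-1.
Proof. exact: fmorphV. Qed.

Lemma frob_iota (a : F) : frob iota (iota a) = iota a.
Proof. by rewrite /frob -rmorphXn expf_card. Qed.

(** The elements of iota F are #|F| roots of X^#|F| - X, hence all of them. *)
Lemma frob_fix (x : L) : frob iota x = x -> exists a, x = iota a.
Proof.
move=> fx; have [/existsP[a /eqP->]|] := boolP [exists a, x == iota a].
  by exists a.
rewrite negb_exists => /forallP xn.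
pose p : {poly L} := 'X^#|F| - 'X.
have size_p : size p = #|F|.+1.
  by rewrite size_polyDl size_polyXn // size_polyN size_polyX ltnS
    finNzRing_gt1.
suff: (size (x :: [seq iota a | a : F]) < size p)%N.
  by rewrite size_p /= size_map -cardT ltnn.
apply: max_poly_roots; first by rewrite -size_poly_eq0 size_p.
- apply/andP; split.
    by rewrite rootE !hornerE -/(frob iota x) fx subrr.
  by apply/allP => _ /mapP[a _ ->];
    rewrite rootE !hornerE -/(frob iota (iota a)) frob_iota subrr.
rewrite cons_uniq; apply/andP; split; last first.
  by rewrite /image_mem (map_inj_uniq (fmorph_inj iota)) enum_uniq.
by apply/mapP => -[a _ e]; have := xn a; rewrite e eqxx.
Qed.

End FrobeniusMorphism.

Section CubicField.
Variables (F L : finFieldType) (iota : {rmorphism F -> L}).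
Hypothesis cardL : #|L| = (#|F| ^ 3)%N.
Local Notation sg := (frob iota).

Lemma frob3 (x : L) : sg (sg (sg x)) = x.
Proof.
have -> : sg (sg (sg x)) = x ^+ (#|F| ^ 3).
  by rewrite /frob -!exprM !expnS expn0 muln1 mulnA.
by rewrite -cardL expf_card.
Qed.

Lemma frob2_fix (x : L) : sg (sg x) = x -> sg x = x.
Proof. by move=> e; rewrite -[in LHS]e frob3. Qed.

Definition norm3 (x : L) : L := x * sg x * sg (sg x).
Definition trace3 (x : L) : L := x + sg x + sg (sg x).

Lemma norm3E (x : L) : norm3 x = x ^+ (#|F| ^ 2 + #|F| + 1).
Proof.
by rewrite /norm3 /frob -exprM !exprD expr1 expnS expn1 [RHS]mulrC -mulrA;
  congr (_ * _); rewrite mulrC.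
Qed.

Lemma frob_norm3 x : sg (norm3 x) = norm3 x.
Proof. by rewrite /norm3 !rmorphM /= frob3 [LHS]mulrC mulrA. Qed.

Lemma norm3M x y : norm3 (x * y) = norm3 x * norm3 y.
Proof. by rewrite /norm3 !rmorphM /=; ring. Qed.

Lemma norm3_eq0 x : (norm3 x == 0) = (x == 0).
Proof. by rewrite /norm3 !mulf_eq0 !fmorph_eq0 !orbb. Qed.

Lemma norm3V x : norm3 x^-1 = (norm3 x)^-1.
Proof. by rewrite /norm3 !fmorphV -!invfM. Qed.

Lemma norm3_frob x : norm3 (sg x) = norm3 x.
Proof. by rewrite -[RHS]frob_norm3 /norm3 !rmorphM. Qed.

Lemma norm3_iota x : exists a, norm3 x = iota a.
Proof. exact/frob_fix/frob_norm3. Qed.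

Lemma trace3Z a x : trace3 (iota a * x) = iota a * trace3 x.
Proof. by rewrite /trace3 !rmorphM /= !frob_iota; ring. Qed.

Lemma frob_trace3 x : sg (trace3 x) = trace3 x.
Proof. by rewrite /trace3 !rmorphD /= frob3 [LHS]addrC addrA. Qed.

Lemma trace3_frob x : trace3 (sg x) = trace3 x.
Proof. by rewrite /trace3 frob3 [LHS]addrC addrA. Qed.

Lemma trace3_iota x : exists a, trace3 x = iota a.
Proof. exact/frob_fix/frob_trace3. Qed.

(** Hilbert 90. As L* is cyclic of order (q - 1)(q^2 + q + 1), the exponent of
    an element of norm 1 with respect to a generator is divisible by q - 1. *)
Lemma hilbert90 (tau k : L) : (#|L|.-1).-primitive_root tau ->
  norm3 k = 1 -> exists2 m, m != 0 & sg m = k * m.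
Proof.
move=> tau_prim; rewrite norm3E => nk1.
have q_gt1 := finNzRing_gt1 F.
have q_gt0 : (0 < #|F|)%N := ltnW q_gt1.
set N := (_ + _ + _)%N in nk1.
have cardE : (#|L|.-1 = #|F|.-1 * N)%N.
  by rewrite cardL predn_exp !big_ord_recr big_ord0 /= add0n expn0 expn1 addnC
    (addnC 1%N) addnA.
have k1 : k ^+ #|L|.-1 = 1 by rewrite cardE mulnC exprM nk1 expr1n.
have [[j _] /= kE] := prim_rootP tau_prim k1.
have : (#|L|.-1 %| j * N)%N by rewrite (prim_order_dvd tau_prim) exprM -kE nk1.
have N_gt0 : (0 < N)%N by rewrite /N addn1.
rewrite cardE dvdn_pmul2r // => /dvdnP[i jE].
exists (tau ^+ i).
  apply/expf_neq0/eqP => tau0; have /eqP := prim_expr_order tau_prim.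
  by rewrite tau0 expr0n -leqn0 leqNgt (prim_order_gt0 tau_prim) eq_sym
    oner_eq0.
rewrite /frob kE jE -!exprM -exprD; congr (_ ^+ _).
by rewrite -{1}(prednK q_gt0) mulnS addnC.
Qed.

(** If m^q = k m, then 1 / m^q is a solution, its q^2-th power being 1 / m. *)
Lemma hilbert90_frob2 (tau k : L) : (#|L|.-1).-primitive_root tau ->
  norm3 k = 1 -> exists2 n, n != 0 & sg (sg n) = k * n.
Proof.
move=> tau_prim nk1; have [m m0 mE] := hilbert90 tau_prim nk1.
have sm0 : sg m != 0 by rewrite fmorph_eq0.
exists (sg m)^-1; first by rewrite invr_eq0.
have k0 : k != 0 by rewrite -norm3_eq0 nk1 oner_neq0.
by rewrite !fmorphV /= frob3 mE invfM mulrA mulfV // mul1r.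
Qed.

End CubicField.

(** * Subspaces given as images of maps *)

(** The sets of vectors whose spans define the planes are already subspaces. *)
Lemma mem_span_image (K : fieldType) (vT : vectType K) (T : finType)
    (A : {pred T}) (h : T -> vT) :
  (exists2 x, x \in A & h x = 0) ->
  (forall a x y, x \in A -> y \in A ->
     exists2 z, z \in A & h z = a *: h x + h y) ->
  forall v, v \in <<[seq h x | x in A]>>%VS <-> exists2 x, x \in A & v = h x.
Proof.
move=> [x0 Ax0 hx0] h_closed v; split=> [|[x Ax ->]]; last first.
  by apply/memv_span/image_f.
move/(@coord_span _ _ _ (in_tuple _)) ->; elim/big_rec: _ => [|i w _ [x Ax ->]].
  by exists x0.
have /imageP[y Ay ->] : [seq h x | x in A]`_i \in [seq h x | x in A].
  exact: mem_nth.
by have [z Az <-] := h_closed (coord (in_tuple [seq h x | x in A]) i v) y x Ay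
  Ax; exists z.
Qed.

(** Over a finite field a dimension is found by counting vectors. *)
Lemma dim_param (K : finFieldType) (n d : nat) (X : subspace K n) (T : finType)
    (h : T -> 'cV[K]_n) :
  (forall y, y \in X <-> exists x, y = h x) -> injective h ->
  #|T| = (#|K| ^ d)%N -> \dim X = d.
Proof.
move=> XE h_inj cardT; apply/eqP.
rewrite -(eqn_exp2l _ _ (finNzRing_gt1 K)) -cardT.
rewrite -(card_vspace X) -(card_codom h_inj); apply/eqP/eq_card => y.
by apply/idP/codomP => /XE.
Qed.

Section Points.
Variables (K : finFieldType) (n : nat).
Implicit Types (X P : subspace K n) (y : 'cV[K]_n).

Lemma point_line P : \dim P = 1%N -> exists2 y, y != 0 & P = <[y]>%VS.
Proof.
move=> dimP; have P0 : P != 0%VS by rewrite -dimv_eq0 dimP.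
exists (vpick P); first by rewrite vpick0.
apply/eqP; rewrite eq_sym eqEdim dimP dim_vline vpick0 P0.
by rewrite -memvE memv_pick.
Qed.

Lemma vline_scale a y : a != 0 -> <[a *: y]>%VS = <[y]>%VS :> subspace K n.
Proof.
move=> a0; apply/vspaceP => z; apply/vlineP/vlineP => -[b ->].
  by exists (b * a); rewrite scalerA.
by exists (b / a); rewrite scalerA divfK.
Qed.

Lemma in_points_of X y : y != 0 -> (<[y]>%VS \in points_of X) = (y \in X).
Proof. by move=> y0; rewrite inE dim_vline y0 memvE. Qed.

Lemma vline_eq y z : y != 0 -> <[y]>%VS = <[z]>%VS :> subspace K n ->
  exists2 a, a != 0 & y = a *: z.
Proof.
move=> y0 e; have /vlineP[a ye] : y \in <[z]>%VS by rewrite -e memv_line.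
by exists a => //; apply: contraNneq y0 => a0; rewrite ye a0 scale0r.
Qed.

Definition free2 y1 y2 := forall a b : K, a *: y1 + b *: y2 = 0 -> a = 0 /\ b =
  0.

Lemma free2_neq0 y1 y2 a b : free2 y1 y2 -> (a, b) != (0, 0) ->
  a *: y1 + b *: y2 != 0.
Proof. by move=> y_free; apply: contraNneq => /y_free[-> ->]. Qed.

Lemma free2_inj y1 y2 : free2 y1 y2 ->
  injective (fun ab : K * K => ab.1 *: y1 + ab.2 *: y2).
Proof.
move=> y_free [a b] [c d] /= /eqP; rewrite -subr_eq0 opprD addrACA -!scalerBl.
by case/eqP/y_free => /subr0_eq-> /subr0_eq->.
Qed.

Lemma mem_vline2 y1 y2 y : y \in (<[y1]> + <[y2]>)%VS <->
  exists ab : K * K, y = ab.1 *: y1 + ab.2 *: y2.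
Proof.
split=> [/memv_addP[_ /vlineP[a ->] [_ /vlineP[b ->] ->]]|[[a b] ->]].
  by exists (a, b).
by rewrite memv_add ?memvZ ?memv_line.
Qed.

Lemma dim_vline2 y1 y2 : free2 y1 y2 -> \dim (<[y1]> + <[y2]>) = 2.
Proof.
move=> y_free.
by rewrite (dim_param (mem_vline2 y1 y2) (free2_inj y_free) (d := 2))
  ?card_prod.
Qed.

Lemma dim2_vline2 X y1 y2 : \dim X = 2 -> free2 y1 y2 -> y1 \in X -> y2 \in X ->
  X = (<[y1]> + <[y2]>)%VS.
Proof.
move=> dimX y_free y1X y2X; apply/eqP.
by rewrite eq_sym eqEdim subv_add -!memvE y1X y2X dimX dim_vline2.
Qed.

Lemma dim2_basis X : \dim X = 2 ->
  exists y1 y2, free2 y1 y2 /\ X = (<[y1]> + <[y2]>)%VS.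
Proof.
move=> dimX; have X0 : X != 0%VS by rewrite -dimv_eq0 dimX.
have y10 : vpick X != 0 by rewrite vpick0.
have y1X := memv_pick X; move: (vpick X) y10 y1X => y1 y10 y1X.
have /subvPn[y2 y2X y2y1] : ~~ (X <= <[y1]>)%VS.
  by apply/negP => /dimvS; rewrite dimX dim_vline y10.
have y_free : free2 y1 y2.
  move=> a b; have [-> /eqP|b0 e] := eqVneq b 0.
    by rewrite scale0r addr0 scaler_eq0 (negPf y10) orbF => /eqP.
  case/vlineP: y2y1; exists (- (a / b)); apply: (scalerI b0).
  rewrite scalerA mulrN mulrCA divff // mulr1 scaleNr; apply/eqP.
  by rewrite -subr_eq0 opprK addrC e.
by exists y1, y2; split=> //; apply: dim2_vline2.
Qed.

End Points.

Section QuadraticForms.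
Variable R : comNzRingType.
Implicit Types (Q : 'M[R]_3) (x y : 'cV[R]_3).

Definition polar Q x y : R := (x^T *m (Q + Q^T) *m y) 0 0.

Lemma polarC Q x y : polar Q x y = polar Q y x.
Proof.
have tr11 (A : 'M[R]_1) : A 0 0 = A^T 0 0 by rewrite mxE.
rewrite /polar [LHS]tr11 !trmx_mul trmxK linearD /= trmxK mulmxA.
by rewrite [Q^T + Q]addrC.
Qed.

Lemma polarDr Q x y y' : polar Q x (y + y') = polar Q x y + polar Q x y'.
Proof. by rewrite /polar mulmxDr mxE. Qed.

Lemma polarZr Q a x y : polar Q x (a *: y) = a * polar Q x y.
Proof. by rewrite /polar -scalemxAr mxE. Qed.

Lemma polarDl Q x x' y : polar Q (x + x') y = polar Q x y + polar Q x' y.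
Proof. by rewrite polarC polarDr !(polarC Q y). Qed.

Lemma polarZl Q a x y : polar Q (a *: x) y = a * polar Q x y.
Proof. by rewrite polarC polarZr polarC. Qed.

Lemma qformZ Q a x : qform Q (a *: x) = a ^+ 2 * qform Q x.
Proof.
by rewrite /qform [(a *: x)^T]linearZ -scalemxAr -!scalemxAl !mxE expr2 mulrA.
Qed.

Lemma qformD Q x y : qform Q (x + y) = qform Q x + qform Q y + polar Q x y.
Proof.
have -> : polar Q x y = (x^T *m Q *m y) 0 0 + (y^T *m Q *m x) 0 0.
  have tr11 (A : 'M[R]_1) : A 0 0 = A^T 0 0 by rewrite mxE.
  rewrite /polar mulmxDr mulmxDl mxE [(y^T *m _ *m _) 0 0]tr11.
  by rewrite !trmx_mul trmxK mulmxA.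
rewrite /qform [(x + y)^T]raddfD /= !mulmxDl !mulmxDr !mxE; ring.
Qed.

Lemma qformE Q x : qform Q x = \sum_i \sum_j x i 0 * Q i j * x j 0.
Proof.
rewrite /qform mxE exchange_big; apply: eq_bigr => j _ /=.
by rewrite mxE big_distrl; apply: eq_bigr => i _; rewrite mxE.
Qed.

End QuadraticForms.

(** The polar form of a quadratic form vanishing on a line is zero on that line,
    so that the polar functionals of its points
    all factor through a quotient of dimension 1 and one of them is zero.
    That point would be singular. *)
Lemma conic_is_not_a_line (K : finFieldType) (n : nat) (X l : subspace K n)
    (C : {set subspace K n}) :
  is_conic_of X C -> \dim l = 2 -> C <> points_of l.
Proof.
case=> M [Q [dimX MX Q_nondeg CE]] dim_l Cl.
have M_inj (u : 'cV_3) : M *m u = 0 -> u = 0.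
  move=> Mu0; have : u \in lker (linfun (mulmx M : 'cV_3 -> 'cV_n)).
    by rewrite memv_ker lfunE /= Mu0.
  have := limg_ker_dim (linfun (mulmx M : 'cV_3 -> 'cV_n)) fullv.
  rewrite MX dimX dimvf /dim /= => /(@addIn 3 _ 0)/eqP.
  by rewrite dimv_eq0 capfv => /eqP ->; rewrite memv0 => /eqP.
have [y1 [y2 [y_free lE']]] := dim2_basis dim_l.
have lE := mem_vline2 y1 y2; rewrite -lE' in lE.
have Q_l u : M *m u \in l -> qform Q u = 0.
  have [-> _|u0] := eqVneq u 0; first by rewrite /qform mulmx0 mxE.
  have Mu0 : M *m u != 0 by apply: contraNneq u0 => /M_inj ->.
  rewrite -in_points_of // -Cl CE => /imsetP[v];
    rewrite inE => /andP[v0 /eqP Qv].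
  case/(vline_eq Mu0) => a _; rewrite scalemxAr => /eqP.
  rewrite -subr_eq0 -mulmxBr => /eqP/M_inj/subr0_eq ->.
  by rewrite qformZ Qv mulr0.
have preim y : y \in l -> exists u, y = M *m u.
  move=> yl; have [->|y0] := eqVneq y 0; first by exists 0; rewrite mulmx0.
  have : <[y]>%VS \in points_of l by rewrite in_points_of.
  rewrite -Cl CE => /imsetP[v _ /(vline_eq y0)[a _ ->]].
  by exists (a *: v); rewrite scalemxAr.
have [u1 y1E] : exists u, y1 = M *m u.
  by apply/preim/lE; exists (1, 0); rewrite scale1r scale0r addr0.
have [u2 y2E] : exists u, y2 = M *m u.
  by apply/preim/lE; exists (0, 1); rewrite scale1r scale0r add0r.
pose W : 'M[K]_(1 + 1, 3) := col_mx u1^T u2^T.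
have MW (c : 'rV_(1 + 1)) :
    M *m (c *m W)^T = lsubmx c 0 0 *: y1 + rsubmx c 0 0 *: y2.
  rewrite -[c in LHS]hsubmxK mul_row_col linearD /= !trmx_mul !trmxK mulmxDr.
  rewrite y1E y2E {1}[lsubmx c]mx11_scalar {1}[rsubmx c]mx11_scalar.
  by rewrite !tr_scalar_mx !mul_mx_scalar -!scalemxAr.
have QW (c : 'rV_(1 + 1)) : qform Q (c *m W)^T = 0.
  by apply/Q_l/lE; exists (lsubmx c 0 0, rsubmx c 0 0); rewrite MW.
have W_free : row_free W.
  apply: inj_row_free => c cW0; have := MW c.
  rewrite cW0 trmx0 mulmx0 => /esym/y_free[c1 c2]; rewrite -[c]hsubmxK.
  by rewrite [lsubmx c]mx11_scalar [rsubmx c]mx11_scalar c1 c2 !raddf0 row_mx0.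
set G := Q + Q^T.
have WGW0 : W *m G *m W^T = 0.
  apply/matrixP => i j; rewrite [in RHS]mxE.
  have := qformD Q (delta_mx 0 i *m W)^T (delta_mx 0 j *m W)^T.
  rewrite -linearD -mulmxDl !QW !add0r /polar trmxK trmx_mul => /esym.
  by rewrite !mulmxA -!mulmxA -rowE !mulmxA trmx_delta -colE !mxE.
(* W has rank 2 and W^T is annihilated by W G, whose rank is at most 3 - 2. *)
have [c c0 cWG0] : exists2 c : 'rV_(1 + 1), c != 0 & c *m (W *m G) = 0.
  have rWG : (\rank (W *m G) < 1 + 1)%N.
    have := mulmx0_rank_max WGW0; rewrite mxrank_tr (eqP W_free).
    by move=> rle; rewrite -(leq_add2r 2); exact: rle.
  exists (nz_row (kermx (W *m G))).
    by rewrite nz_row_eq0 kermx_eq0 neq_ltn rWG.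
  by apply/sub_kermxP/nz_row_sub.
have w0 : (c *m W)^T != 0.
  by rewrite -[0]trmx0 (inj_eq trmx_inj) mulmx_free_eq0.
have Gw0 : G *m (c *m W)^T = 0.
  have GT : G^T = G by rewrite /G linearD /= trmxK addrC.
  by rewrite -GT -trmx_mul -mulmxA cWG0 trmx0.
by have /eqP[] := Q_nondeg _ w0 Gw0; rewrite QW.
Qed.

(** * Spread planes, cover planes and sublines *)

Section FieldReduction.
Variables (F L : finFieldType) (iota : {rmorphism F -> L}).
Hypothesis cardL : #|L| = (#|F| ^ 3)%N.
Variables (n : nat) (S : subspace F n).
Local Notation sg := (frob iota).
Implicit Types (J : L -> L -> 'cV[F]_n) (e f k m s x : L) (Z : {set L})
  (R : {set subspace F n}).

(** An F-linear embedding of L x L into S. It stands for the composite of the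
    Bruck-Bose map of the line at infinity with a coordinate change, so that the
    statements below hold for all exterior subplanes at once. *)
Definition field_reduction J : Prop :=
  [/\ forall a x y x' y',
        J (iota a * x + x') (iota a * y + y') = a *: J x y + J x' y',
      forall x y, J x y = 0 -> x = 0 /\ y = 0 &
      forall x y, J x y \in S].

Definition swap J x y := J y x.

Lemma swap_field_reduction J : field_reduction J -> field_reduction (swap J).
Proof. by case=> lin inj inS; split=> [||x y];
  [|move=> x y /inj[-> ->]|apply: inS] => // *; apply: lin. Qed.

(** The spread plane of the point (s, s^q) of the line at infinity. *)
Definition spread_plane J s : subspace F n :=
  <<[seq J (s * x)%R (sg s * x)%R | x : L]>>%VS.

(** The tangent cover has r = 1 and the conic cover has r = 2. *)
Definition cover_of J r k : subspace F n :=
  <<[seq J (k * x)%R (iter r sg x) | x : L]>>%VS.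

Definition spread_planes J Z : {set subspace F n} :=
  [set spread_plane J s | s in Z].

Definition indep e f :=
  forall a b : F, iota a * e + iota b * f = 0 -> a = 0 /\ b = 0.

Definition F_line e f : {set L} :=
  [set s | (s != 0) &&
     [exists ab : F * F, s == iota ab.1 * e + iota ab.2 * f]].

Lemma F_lineP e f s : reflect
  (s != 0 /\ exists a b, s = iota a * e + iota b * f) (s \in F_line e f).
Proof.
rewrite inE; apply: (iffP andP) => -[s0].
  by case/existsP => -[a b] /eqP sE; split=> //; exists a, b.
by case=> a [b sE]; split=> //; apply/existsP; exists (a, b); apply/eqP.
Qed.

Lemma indep_scale m e f : m != 0 -> indep e f -> indep (m * e) (m * f).
Proof.
move=> m0 ef a b; rewrite ![iota _ * (m * _)]mulrCA -mulrDr => /eqP.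
by rewrite mulf_eq0 (negPf m0) orFb => /eqP; apply: ef.
Qed.

Lemma indep_sym e f : indep e f -> indep f e.
Proof. by move=> ef a b; rewrite addrC => /(ef b a)[]. Qed.

Lemma indep_neq0 e f : indep e f -> e != 0.
Proof.
move=> ef; apply: contraTneq isT => e0; have := ef 1 0.
by rewrite e0 mulr0 rmorph0 mul0r addr0 => /(_ erefl)[/eqP]; rewrite oner_eq0.
Qed.

(** Otherwise f / e is fixed by the Frobenius map, hence in F. *)
Lemma indep_det e f : indep e f -> e * sg f - f * sg e != 0.
Proof.
move=> ef; have e0 := indep_neq0 ef; have f0 := indep_neq0 (indep_sym ef).
apply: contraT; rewrite negbK subr_eq0 => /eqP efE.
have [a /eqP] : exists a, f / e = iota a.
  apply: frob_fix; rewrite rmorphM fmorphV /=; apply: (mulIf e0).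
  have se0 : sg e != 0 by rewrite fmorph_eq0.
  apply: (mulIf se0); rewrite divfK //.
  by rewrite mulrAC divfK // mulrC.
rewrite -(inj_eq (mulIf e0)) divfK // => /eqP fE.
have [] := ef (- a) 1; last by move=> _ /eqP; rewrite oner_eq0.
by rewrite fE rmorphN rmorph1 mul1r mulNr addNr.
Qed.

Section Planes.
Variable J : L -> L -> 'cV[F]_n.
Hypothesis J_red : field_reduction J.

Lemma field_reductionZ a x y : J (iota a * x) (iota a * y) = a *: J x y.
Proof.
have [lin _ _] := J_red; have J0 : J 0 0 = 0.
  by apply: (addIr (J 0 0)); have := lin 1 0 0 0 0;
    rewrite rmorph1 scale1r !mul1r !addr0 add0r => <-.
by have := lin a x y 0 0; rewrite J0 !addr0.
Qed.

Lemma field_reduction0 : J 0 0 = 0.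
Proof. by have := field_reductionZ 0 0 0; rewrite rmorph0 mul0r scale0r. Qed.

Lemma field_reductionD x y x' y' : J (x + x') (y + y') = J x y + J x' y'.
Proof.
have [lin _ _] := J_red.
by have := lin 1 x y x' y'; rewrite rmorph1 !mul1r scale1r.
Qed.

Lemma field_reduction_inj x y x' y' : J x y = J x' y' -> x = x' /\ y = y'.
Proof.
move/eqP; rewrite -subr_eq0 -[J x' y']scale1r -scaleNr -field_reductionZ.
rewrite -field_reductionD rmorphN rmorph1 !mulN1r => /eqP.
by have [_ inj _] := J_red => /inj[/subr0_eq-> /subr0_eq->].
Qed.

Lemma field_reduction_neq0 x y : (x != 0) || (y != 0) -> J x y != 0.
Proof.
by rewrite -negb_and; apply: contraNneq; have [_ inj _] := J_red => /inj[-> ->];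
  rewrite !eqxx.
Qed.

(** All planes below are images of L under an F-linear map of this form. *)
Lemma mem_plane (g h : L -> L) :
  (forall a x y, g (iota a * x + y) = iota a * g x + g y) ->
  (forall a x y, h (iota a * x + y) = iota a * h x + h y) ->
  forall y, y \in <<[seq J (g x) (h x) | x : L]>>%VS <-> exists x, y = J (g x)
    (h x).
Proof.
move=> g_lin h_lin y; have [lin _ _] := J_red.
have [|a x x' _ _|to_ex of_ex] := @mem_span_image _ _ _ predT
  (fun x => J (g x) (h x)) _ _ y.
- exists 0 => //; have := g_lin (-1) 0 0; have := h_lin (-1) 0 0.
  by rewrite rmorphN1 !mulN1r oppr0 addr0 !addNr => -> ->;
    apply: field_reduction0.
- by exists (iota a * x + x') => //; rewrite g_lin h_lin lin.
by split=> [/to_ex[x _ yE]|[x yE]]; [exists x | apply: of_ex; exists x].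
Qed.

Lemma mul_lin k a x y : k * (iota a * x + y) = iota a * (k * x) + k * y.
Proof. by rewrite mulrDr mulrCA. Qed.

Lemma iter_frob_lin r a x y :
  iter r sg (iota a * x + y) = iota a * iter r sg x + iter r sg y.
Proof.
by elim: r => //= r ->; rewrite rmorphD rmorphM /= frob_iota.
Qed.

Lemma spread_planeP s y :
  y \in spread_plane J s <-> exists x, y = J (s * x) (sg s * x).
Proof. by apply: mem_plane => *; apply: mul_lin. Qed.

Lemma cover_ofP r k y :
  y \in cover_of J r k <-> exists x, y = J (k * x) (iter r sg x).
Proof. by apply: mem_plane => *; [apply: mul_lin | apply: iter_frob_lin]. Qed.

Lemma spread_plane_scale a s : a != 0 ->
  spread_plane J (iota a * s) = spread_plane J s.
Proof.
move=> a0; have ia0 : iota a != 0 by rewrite fmorph_eq0.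
apply/vspaceP => y; apply/idP/idP => /spread_planeP[x ->]; apply/spread_planeP.
  by exists (iota a * x); rewrite rmorphM /= frob_iota -!mulrA
    !(mulrCA s, mulrCA (sg s)).
exists (x / iota a); rewrite rmorphM /= frob_iota.
by congr J; field.
Qed.

(** The second coordinate x^(q^r) of a point determines x, and then the first
    coordinate k x determines k. *)
Lemma cover_of_disjoint r k k' y : y != 0 ->
  y \in cover_of J r k -> y \in cover_of J r k' -> k = k'.
Proof.
move=> y0 /cover_ofP[x yE] /cover_ofP[x' yE'].
have [kE /esym xE] := field_reduction_inj (etrans (esym yE) yE').
have iter_inj : injective (iter r sg).
  by elim: r {yE yE' xE} => //= r IH u v /fmorph_inj/IH.
move: (iter_inj _ _ xE) => x'E.
have x0 : x != 0.
  apply: contraNneq y0 => x0; have iter0 : iter r sg 0 = 0.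
    by elim: r {yE yE' xE iter_inj x'E} => //= r ->; rewrite rmorph0.
  by rewrite yE x0 iter0 mulr0 field_reduction0.
by apply: (mulIf x0); rewrite kE x'E.
Qed.

(** The equation s z = k x, s^q z = x^q says that x / (m s) is fixed by the
    Frobenius map, where k = m^(q-1). *)
Lemma tangent_meets_spread k m s x : m != 0 -> s != 0 -> sg m = k * m ->
  J (k * x) (iter 1 sg x) \in spread_plane J s <-> exists a, x = iota a *
    (m * s).
Proof.
move=> m0 s0 mE; have sm0 : sg m != 0 by rewrite fmorph_eq0.
have ss0 : sg s != 0 by rewrite fmorph_eq0.
have k0 : k != 0 by apply: contraNneq sm0 => k0; rewrite mE k0 mul0r.
have kE : k = sg m / m by rewrite mE mulfK.
rewrite spread_planeP; split=> [[z /field_reduction_inj[/= kx sx]]|[a ->]].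
  have [a aE] : exists a, x / (m * s) = iota a.
    apply: frob_fix; rewrite !(frobM, frobV) sx.
    have -> : x = s * z / k by rewrite -kx mulrC mulKf.
    by rewrite kE; field; rewrite m0 sm0 ss0 s0.
  by exists a; rewrite -aE divfK // mulf_neq0.
exists (iota a * sg m); rewrite /= !frobM frob_iota kE.
by congr J; field.
Qed.

(** Here x / (m s s^(q^2)) is fixed by the square of the Frobenius map, which
    generates the same group of order 3. *)
Lemma conic_meets_spread k m s x : m != 0 -> s != 0 -> sg (sg m) = k * m ->
  J (k * x) (iter 2 sg x) \in spread_plane J s <->
  exists a, x = iota a * (m * (s * sg (sg s))).
Proof.
move=> m0 s0 mE; have sm0 : sg (sg m) != 0 by rewrite !fmorph_eq0.
have ss0 : sg s != 0 by rewrite fmorph_eq0.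
have sss0 : sg (sg s) != 0 by rewrite !fmorph_eq0.
have k0 : k != 0 by apply: contraNneq sm0 => k0; rewrite mE k0 mul0r.
have kE : k = sg (sg m) / m by rewrite mE mulfK.
rewrite spread_planeP; split=> [[z /field_reduction_inj[/= kx sx]]|[a ->]].
  have [a aE] : exists a, x / (m * (s * sg (sg s))) = iota a.
    apply: frob_fix; apply: (frob2_fix cardL).
    rewrite !(frobM, frobV) (frob3 _ cardL) sx.
    have -> : x = s * z / k by rewrite -kx mulrC mulKf.
    by rewrite kE; field; rewrite m0 sm0 ss0 sss0 s0.
  by exists a; rewrite -aE divfK // !mulf_neq0.
exists (iota a * sg (sg m) * sg (sg s)).
rewrite /= !frobM (frob3 _ cardL) !frob_iota kE.
by congr J; field.
Qed.

End Planes.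

End FieldReduction.

(** * Where a set of spread planes meets a cover plane *)

Section CoverSections.
Variables (F L : finFieldType) (iota : {rmorphism F -> L}).
Hypothesis cardL : #|L| = (#|F| ^ 3)%N.
Variables (n : nat) (S : subspace F n) (J : L -> L -> 'cV[F]_n).
Hypothesis J_red : field_reduction iota S J.
Local Notation sg := (frob iota).
Local Notation spread_plane := (spread_plane iota J).
Local Notation spread_planes := (spread_planes iota J).
Local Notation cover_of := (cover_of iota J).
Local Notation indep := (indep iota).
Local Notation F_line := (F_line iota).

(** The coordinate x on a cover plane in which all sections are computed. *)
Definition cover_pt r k x := J (k * x) (iter r sg x).

Lemma cover_pt_lin r k a x y :
  cover_pt r k (iota a * x + y) = a *: cover_pt r k x + cover_pt r k y.
Proof.
by have [lin _ _] := J_red; rewrite /cover_pt mul_lin iter_frob_lin lin.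
Qed.

Lemma cover_pt0 r k : cover_pt r k 0 = 0.
Proof.
have := cover_pt_lin r k (-1) 0 0.
by rewrite rmorphN1 mulN1r oppr0 addr0 scaleN1r addNr.
Qed.

Lemma cover_ptZ r k a x : cover_pt r k (iota a * x) = a *: cover_pt r k x.
Proof. by rewrite -[_ * _]addr0 cover_pt_lin cover_pt0 addr0. Qed.

Lemma cover_pt_inj r k : injective (cover_pt r k).
Proof.
move=> x y /(field_reduction_inj J_red)[_].
by elim: r x y => //= r IH x y /fmorph_inj/IH.
Qed.

Lemma cover_pt_neq0 r k x : x != 0 -> cover_pt r k x != 0.
Proof. by apply: contraNneq; rewrite -(cover_pt0 r k) => /cover_pt_inj->. Qed.

Lemma dim_cover_of r k : \dim (cover_of r k) = 3.
Proof. exact: dim_param (cover_ofP J_red r k) (@cover_pt_inj r k) cardL. Qed.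

Lemma section_cover r k (Z : {set L}) (g : L -> L) :
  (forall s, s \in Z -> g s != 0 /\
     forall x, cover_pt r k x \in spread_plane s <-> exists a, x = iota a * g
       s) ->
  section (spread_planes Z) (cover_of r k) = [set <[cover_pt r k (g s)]>%VS | s
    in Z].
Proof.
move=> gZ; apply/setP => P; apply/idP/imsetP => [|[s Zs ->]].
  rewrite !inE => /andP[/andP[/eqP/point_line[y y0 ->] yX]].
  case/existsP => _ /andP[/imsetP[s Zs ->]]; rewrite -!memvE in yX *.
  case/(cover_ofP J_red): yX y0 => x -> xk0.
  have [_ gP] := gZ s Zs; case/gP => a xE.
  exists s => //; rewrite -/(cover_pt r k x) xE cover_ptZ vline_scale //.
  apply: contraNneq xk0 => a0.
  by rewrite -/(cover_pt r k x) xE a0 rmorph0 mul0r cover_pt0.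
have [gs0 gP] := gZ s Zs; rewrite !inE dim_vline cover_pt_neq0 //= -memvE.
apply/andP; split; first by apply/(cover_ofP J_red); exists (g s).
apply/existsP; exists (spread_plane s); rewrite imset_f //= -memvE.
by apply/gP; exists 1; rewrite rmorph1 mul1r.
Qed.

Variables (tau : L) (tau_prim : (#|L|.-1).-primitive_root tau).

(** In the coordinate x on a tangent cover plane, the section by the points
    (s, s^q) with s in Z is the image m Z of Z under a scaling. *)
Lemma tangent_section k (Z : {set L}) : norm3 iota k = 1 ->
  (forall s, s \in Z -> s != 0) ->
  exists2 m, m != 0 &
    section (spread_planes Z) (cover_of 1 k) = [set <[cover_pt 1 k (m * s)]>%VS
      | s in Z].
Proof.
move=> nk Z0; have [m m0 mE] := hilbert90 cardL tau_prim nk.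
exists m => //; apply: section_cover => s /Z0 s0.
by rewrite mulf_neq0 //; split=> // x; apply: (tangent_meets_spread J_red).
Qed.

Lemma conic_section k (Z : {set L}) : norm3 iota k = 1 ->
  (forall s, s \in Z -> s != 0) ->
  exists2 m, m != 0 &
    section (spread_planes Z) (cover_of 2 k) =
    [set <[cover_pt 2 k (m * (s * sg (sg s)))]>%VS | s in Z].
Proof.
move=> nk Z0; have [m m0 mE] := hilbert90_frob2 cardL tau_prim nk.
exists m => //; apply: section_cover => s /Z0 s0.
rewrite !mulf_neq0 ?fmorph_eq0 //; split=> // x.
by apply: (conic_meets_spread cardL J_red).
Qed.

Lemma F_line_neq0 e f s : s \in F_line e f -> s != 0.
Proof. by case/F_lineP. Qed.

Lemma pencil_meets_tangent e f k : indep e f -> norm3 iota k = 1 ->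
  meets_in_a_line (spread_planes (F_line e f)) (cover_of 1 k).
Proof.
move=> ef nk; have [m m0 sectE] := tangent_section nk (@F_line_neq0 e f).
pose y1 := cover_pt 1 k (m * e); pose y2 := cover_pt 1 k (m * f).
have y12E a b : cover_pt 1 k (m * (iota a * e + iota b * f)) = a *: y1 + b *:
  y2.
  by rewrite mulrDr ![m * (iota _ * _)]mulrCA cover_pt_lin cover_ptZ.
have y_free : free2 y1 y2.
  move=> a b; rewrite -y12E -(cover_pt0 1 k) => /cover_pt_inj/eqP.
  by rewrite mulf_eq0 (negPf m0) orFb => /eqP; apply: ef.
pose l := (<[y1]> + <[y2]>)%VS.
have lP : forall y, y \in l <-> _ := mem_vline2 y1 y2.
exists l; split.
- exact: dim_vline2.
- apply/subvP => y /lP[[a b] ->] /=; rewrite -y12E.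
  by apply/(cover_ofP J_red); eexists.
rewrite sectE; apply/setP => P;
  apply/imsetP/idP => [[s /F_lineP[s0 [a [b sE]]] ->]|].
  rewrite in_points_of ?cover_pt_neq0 ?mulf_neq0 //.
  by apply/lP; exists (a, b); rewrite sE y12E.
rewrite inE => /andP[/eqP/point_line[y y0 ->]];
  rewrite -memvE => /lP[[a b] /= yE].
exists (iota a * e + iota b * f); last by rewrite y12E -yE.
apply/F_lineP; split; last by exists a, b.
by apply: contraNneq y0 => s0; rewrite yE -y12E s0 mulr0 cover_pt0.
Qed.

(** Scaling back by 1 / m, the line of the section becomes an F-line with the
    same points as Z. *)
Lemma line_in_tangent_pencil k (Z : {set L}) : norm3 iota k = 1 ->
  (forall s, s \in Z -> s != 0) ->
  meets_in_a_line (spread_planes Z) (cover_of 1 k) ->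
  exists e f, indep e f /\ spread_planes Z = spread_planes (F_line e f).
Proof.
move=> nk Z0 [l [dim_l lX sectE]].
have [m m0 sectE'] := tangent_section nk Z0.
have [y1 [y2 [y_free lE]]] := dim2_basis dim_l.
have lP := mem_vline2 y1 y2; rewrite -lE in lP.
have in_l y : y \in l -> exists x, y = cover_pt 1 k (m * x).
  move/(subvP lX)/(cover_ofP J_red) => [x ->]; exists (m^-1 * x).
  by rewrite mulVKf.
have [e y1E] : exists x, y1 = cover_pt 1 k (m * x).
  by apply/in_l/lP; exists (1, 0); rewrite scale1r scale0r addr0.
have [f y2E] : exists x, y2 = cover_pt 1 k (m * x).
  by apply/in_l/lP; exists (0, 1); rewrite scale1r scale0r add0r.
have y12E a b : cover_pt 1 k (m * (iota a * e + iota b * f)) = a *: y1 + b *: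
  y2.
  by rewrite mulrDr ![m * (iota _ * _)]mulrCA cover_pt_lin cover_ptZ y1E y2E.
have ef : indep e f.
  by move=> a b ab0; apply: y_free; rewrite -y12E ab0 mulr0 cover_pt0.
exists e, f; split=> //.
have ptE s : s != 0 -> (<[cover_pt 1 k (m * s)]>%VS \in points_of l) =
  (s \in F_line e f).
  move=> s0; rewrite in_points_of ?cover_pt_neq0 ?mulf_neq0 //.
  apply/idP/F_lineP => [/lP[[a b]]|[_ [a [b ->]]]].
    by rewrite -y12E => /cover_pt_inj/(mulfI m0) /= sE; split=> //; exists a, b.
  by apply/lP; exists (a, b); rewrite y12E.
apply/setP => Y; apply/imsetP/imsetP => -[s sZ ->].
  exists s => //; rewrite -ptE ?Z0 // -sectE sectE'.
  exact: (imset_f (fun s => <[cover_pt 1 k (m * s)]>%VS)).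
have s0 := F_line_neq0 sZ; move: sZ; rewrite -ptE // -sectE sectE'.
have ms0 : cover_pt 1 k (m * s) != 0 by rewrite cover_pt_neq0 ?mulf_neq0.
case/imsetP => s' Zs' /(vline_eq ms0)[a a0]; rewrite -cover_ptZ mulrCA.
move=> /cover_pt_inj/(mulfI m0) ->; exists s' => //.
by rewrite (spread_plane_scale J_red).
Qed.

End CoverSections.

Definition col3 (R : nzRingType) (a b c : R) : 'cV[R]_3 :=
  \col_(i < 3) nth 0 [:: a; b; c] i.

Lemma col3E (R : nzRingType) (v : 'cV[R]_3) :
  v = col3 (v 0 0) (v 1 0) (v (1 + 1) 0).
Proof.
apply/colP => -[[|[|[|i]]] lti] //; rewrite mxE /=; congr (v _ _);
  exact: val_inj.
Qed.

Lemma col3_eq0 (R : nzRingType) (a b c : R) :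
  (col3 a b c == 0) = [&& a == 0, b == 0 & c == 0].
Proof.
apply/eqP/and3P => [/colP v0 | [/eqP-> /eqP-> /eqP->]].
  by have := (v0 0, v0 1, v0 (1 + 1)); rewrite !mxE /= => -[[-> ->] ->].
by apply/colP => -[[|[|[|i]]] lti]; rewrite !mxE.
Qed.

(** The quadratic form x z - y^2. *)
Definition standard_conic (R : nzRingType) : 'M[R]_3 :=
  delta_mx 0 (1 + 1) - delta_mx 1 1.

Lemma qform_standard_conic (R : comNzRingType) (a b c : R) :
  qform (standard_conic R) (col3 a b c) = a * c - b ^+ 2.
Proof.
rewrite /qform /standard_conic !(mxE, big_ord_recl, big_ord0) /=; ring.
Qed.

Lemma standard_conic_nondegenerate (K : fieldType) :
  nondegenerate (standard_conic K).
Proof.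
move=> w; rewrite (col3E w) col3_eq0; move: (w 0 0) (w 1 0) (w (1 + 1) 0) =>
  a b c.
move=> w0 /colP Gw; have := (Gw 0, Gw (1 + 1)).
rewrite !(mxE, big_ord_recl, big_ord0) /= => -[c0 a0].
move: c0 a0 w0; rewrite !(subr0, add0r, addr0, mul0r, mul1r) => -> ->.
rewrite !eqxx andbT /= => b0.
by rewrite qform_standard_conic mul0r sub0r oppr_eq0 sqrf_eq0.
Qed.

(** The products of pairs of elements of a basis of an F-line, polarised, are
    independent. With A and B as below a relation between them reads
    A e'' + B f'' = 0, where '' is the square of the Frobenius map, and by
    symmetry A'' e + B'' f = 0. Its other conjugate A' e + B' f = 0 shows that
    A / B is fixed by the Frobenius map, and then that e / f is. *)
Lemma indep_products (F L : finFieldType) (iota : {rmorphism F -> L})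
    (sg := frob iota) (e f : L) (a b c : F) :
  #|L| = (#|F| ^ 3)%N -> indep iota e f ->
  iota a * (e * sg (sg e)) + iota b * (e * sg (sg f) + f * sg (sg e))
    + iota c * (f * sg (sg f)) = 0 ->
  [/\ a = 0, b = 0 & c = 0].
Proof.
move=> cardL ef rel; have e0 := indep_neq0 ef;
  have f0 := indep_neq0 (indep_sym ef).
pose A := iota a * e + iota b * f; pose B := iota b * e + iota c * f.
have sgA : sg A = iota a * sg e + iota b * sg f.
  by rewrite /sg frobD !frobM !frob_iota.
have sgB : sg B = iota b * sg e + iota c * sg f.
  by rewrite /sg frobD !frobM !frob_iota.
have rel1 : e * sg A + f * sg B = 0.
  have : sg (A * sg (sg e) + B * sg (sg f)) = 0.
    by rewrite -[RHS](rmorph0 sg) -[in RHS]rel /A /B; congr sg; ring.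
  by rewrite /sg frobD !frobM !frob3 // => <-; ring.
have rel2 : e * sg (sg A) + f * sg (sg B) = 0.
  rewrite sgA sgB /sg !frobD !frobM !frob_iota -/sg -[RHS]rel; ring.
have [B0|B0] := eqVneq B 0.
  have A0 : A = 0.
    move: rel1; rewrite B0 /sg rmorph0 mulr0 addr0 => /eqP.
    by rewrite mulf_eq0 (negPf e0) fmorph_eq0 => /eqP.
  by have [-> ->] := ef _ _ A0; have [_ ->] := ef _ _ B0.
have sB0 : sg B != 0 by rewrite fmorph_eq0.
have rE : sg (A / B) = - (f / e).
  rewrite /sg frobM frobV -/sg; apply: (mulIf sB0); rewrite divfK //.
  by apply: (mulfI e0); rewrite -[LHS]subr0 -rel1; field.
have srE : sg (sg (A / B)) = - (f / e).
  rewrite /sg !(frobM, frobV) -/sg;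
    have ssB0 : sg (sg B) != 0 by rewrite fmorph_eq0.
  apply: (mulIf ssB0); rewrite divfK //.
  by apply: (mulfI e0); rewrite -[LHS]subr0 -rel2; field.
have [l lE] : exists l, A / B = iota l.
  by apply: frob_fix; apply: (fmorph_inj sg); apply: etrans srE (esym rE).
have [] := ef l 1; last by move=> _ /eqP; rewrite oner_eq0.
by rewrite -(frob_iota iota l) -lE -/sg rE rmorph1; field.
Qed.

Section CoverConics.
Variables (F L : finFieldType) (iota : {rmorphism F -> L}).
Hypothesis cardL : #|L| = (#|F| ^ 3)%N.
Variables (n : nat) (S : subspace F n) (J : L -> L -> 'cV[F]_n).
Hypothesis J_red : field_reduction iota S J.
Variables (tau : L) (tau_prim : (#|L|.-1).-primitive_root tau).
Local Notation sg := (frob iota).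
Local Notation spread_planes := (spread_planes iota J).
Local Notation cover_of := (cover_of iota J).
Local Notation indep := (indep iota).
Local Notation F_line := (F_line iota).
Local Notation cover_pt := (cover_pt iota J).

(** On a conic cover plane the section is parametrised by s s^(q^2), a
    quadratic form in the coefficients of s = a e + b f. *)
Lemma pencil_meets_conic e f k : indep e f -> norm3 iota k = 1 ->
  meets_in_a_conic (spread_planes (F_line e f)) (cover_of 2 k).
Proof.
move=> ef nk; have [m m0 sectE] := conic_section cardL J_red tau_prim nk
  (@F_line_neq0 _ _ iota e f).
pose b0 := e * sg (sg e); pose b1 := e * sg (sg f) + f * sg (sg e).
pose b2 := f * sg (sg f).
pose p x := cover_pt 2 k (m * x).
have pE a b c x y z : p (iota a * x + iota b * y + iota c * z) =
    a *: p x + b *: p y + c *: p z.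
  rewrite /p !mulrDr ![m * (iota _ * _)]mulrCA -!addrA !(cover_pt_lin J_red).
  by rewrite (cover_ptZ J_red).
pose M : 'M[F]_(n, 3) := \matrix_(i, j) p (nth 0 [:: b0; b1; b2] j) i 0.
have ME a b c : M *m col3 a b c = p (iota a * b0 + iota b * b1 + iota c * b2).
  rewrite pE; apply/colP => i.
  by rewrite !mxE !big_ord_recl big_ord0 !mxE /=; ring.
have p_inj x y : p x = p y -> x = y.
  by move/(cover_pt_inj J_red)/(mulfI m0).
have p0 : p 0 = 0 by rewrite /p mulr0 (cover_pt0 J_red).
have M_inj (v : 'cV_3) : M *m v = 0 -> v = 0.
  rewrite (col3E v) ME -p0 => /p_inj/(indep_products cardL ef)[-> -> ->].
  by apply/eqP; rewrite col3_eq0 !eqxx.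
have imM : (linfun (mulmx M : 'cV_3 -> 'cV_n) @: fullv)%VS = cover_of 2 k.
  apply/eqP; rewrite eqEdim; apply/andP; split.
    apply/subvP => _ /memv_imgP[v _ ->]; rewrite lfunE /= (col3E v) ME.
    by apply/(cover_ofP J_red); eexists.
  rewrite (dim_cover_of cardL J_red) limg_dim_eq ?dimvf ?/dim /= ?muln1 //.
  apply/vspaceP => v; rewrite capfv memv_ker lfunE /= memv0.
  by apply/eqP/eqP => [/M_inj|->]; rewrite ?mulmx0.
exists M, (standard_conic F); split;
  [exact: (dim_cover_of cardL J_red) | exact: imM | exact:
  standard_conic_nondegenerate |].
have sME a b : let s := iota a * e + iota b * f in
    M *m col3 (a ^+ 2) (a * b) (b ^+ 2) = p (s * sg (sg s)).
  move=> s; rewrite ME /s !frobD !frobM !frob_iota !(rmorphXn iota)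
    (rmorphM iota) /=.
  by congr p; rewrite /b0 /b1 /b2; ring.
rewrite sectE; apply/setP => P; apply/imsetP/imsetP =>
  [[s /F_lineP[s0 [a [b sE]]] ->]|].
  exists (col3 (a ^+ 2) (a * b) (b ^+ 2)); last by rewrite sME -sE.
  rewrite inE qform_standard_conic -exprMn subrr eqxx andbT.
  apply: contraNneq s0 => ab0; have := sME a b; rewrite ab0 mulmx0 -p0.
  by move/p_inj/esym/eqP; rewrite -sE !mulf_eq0 !fmorph_eq0 orbb.
case=> v; rewrite inE (col3E v) col3_eq0 qform_standard_conic.
move: (v 0 0) (v 1 0) (v (1 + 1) 0) => a b c /andP[v0 /eqP/subr0_eq ac] ->.
have s_in a' b' : (a' != 0) || (b' != 0) -> iota a' * e + iota b' * f \in F_line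
  e f.
  move=> ab0; apply/F_lineP; split; last by exists a', b'.
  apply: contraTneq ab0 => /ef[-> ->]; by rewrite !eqxx.
(* A zero (a, b, c) of x z - y^2 is proportional to (a^2, a b, b^2), or to
   (0, 0, 1) if a = 0. *)
have [a0|a0] := eqVneq a 0; last first.
  exists (iota a * e + iota b * f); first by rewrite s_in ?a0.
  rewrite -/(p _) -sME -ac; have -> : col3 (a ^+ 2) (a * b) (a * c) = a *: col3
    a b c.
    by apply/colP => -[[|[|[|i]]] lti]; rewrite !mxE //= expr2.
  by rewrite -scalemxAr vline_scale.
have b0' : b = 0 by apply/eqP; rewrite -sqrf_eq0 -ac a0 mul0r.
have c0 : c != 0 by move: v0; rewrite a0 b0' !eqxx.
exists (iota 0 * e + iota 1 * f); first by rewrite s_in ?oner_neq0 ?orbT.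
rewrite -/(p _) -sME a0 b0' expr0n mul0r expr1n.
have -> : col3 0 0 c = c *: col3 0 0 1.
  by apply/colP => -[[|[|[|i]]] lti]; rewrite !mxE ?mulr0 ?mulr1.
by rewrite -scalemxAr vline_scale.
Qed.

(** Distinct planes of a cover are disjoint. *)
Lemma cover_lines_distinct R r k k' l :
  meets_in_the_line R (cover_of r k) l -> meets_in_the_line R (cover_of r k')
    l ->
  k = k'.
Proof.
case=> dim_l lX _ [_ lX' _]; have l0 : vpick l != 0 by rewrite vpick0 -dimv_eq0
  dim_l.
apply: (cover_of_disjoint J_red l0 (subvP lX _ _) (subvP lX' _ _));
  exact: memv_pick.
Qed.

Lemma line_section_is_not_conic (R : {set subspace F n}) X :
  meets_in_a_line R X -> meets_in_a_conic R X -> False.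
Proof. by move=> [l [dim_l _ sectE]] /conic_is_not_a_line/(_ dim_l). Qed.

End CoverConics.

(** * Reguli of spread planes *)

Lemma vpick_cap (K : fieldType) (vT : vectType K) (U V : {vspace vT}) :
  (U :&: V != 0)%VS -> exists y, [/\ y != 0, y \in U & y \in V].
Proof.
move=> UV0; exists (vpick (U :&: V)); rewrite vpick0 UV0.
by have := memv_pick (U :&: V); rewrite memv_cap => /andP[-> ->].
Qed.

Lemma cap_neq0 (K : fieldType) (vT : vectType K) (U V : {vspace vT}) y :
  y != 0 -> y \in U -> y \in V -> (U :&: V != 0)%VS.
Proof.
move=> y0 yU yV; apply: contraNneq y0 => UV0.
by rewrite -memv0 -UV0 memv_cap yU.
Qed.

Section Reguli.
Variables (F L : finFieldType) (iota : {rmorphism F -> L}).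
Hypothesis cardL : #|L| = (#|F| ^ 3)%N.
Variables (n : nat) (S : subspace F n).
Local Notation sg := (frob iota).
Local Notation field_reduction := (field_reduction iota S).

(** The pure tensors with second factor (a, b), in L x L seen as the tensor
    product of L and F^2. *)
Definition regulus_plane (J : L -> L -> 'cV[F]_n) (ab : F * F) : subspace F n :=
  <<[seq J (iota ab.1 * x)%R (iota ab.2 * x)%R | x : L]>>%VS.

Definition base_regulus (J : L -> L -> 'cV[F]_n) : {set subspace F n} :=
  [set regulus_plane J ab | ab : F * F & ab != (0, 0)].

(** One vector for each point of PG(1, q). *)
Definition proj_pt (t : option F) : F * F :=
  if t is Some a then (a, 1) else (1, 0).

Lemma proj_pt_neq0 t : proj_pt t != (0, 0).
Proof. by case: t => [a|]; rewrite xpair_eqE oner_eq0 ?andbF. Qed.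

Lemma proj_pt_inj t t' :
  (proj_pt t).1 * (proj_pt t').2 = (proj_pt t).2 * (proj_pt t').1 -> t = t'.
Proof.
case: t t' => [a|] [b|] //=; rewrite ?mulr1 ?mul1r ?mulr0 ?mul0r.
- by move->.
- by move/eqP; rewrite eq_sym oner_eq0.
- by move/eqP; rewrite oner_eq0.
Qed.

Section BaseRegulus.
Variable J : L -> L -> 'cV[F]_n.
Hypothesis J_red : field_reduction J.
Local Notation cx t := (iota (proj_pt t).1).
Local Notation cy t := (iota (proj_pt t).2).

Lemma regulus_planeP ab y : y \in regulus_plane J ab <->
  exists x, y = J (iota ab.1 * x) (iota ab.2 * x).
Proof. by apply: (mem_plane J_red) => *; apply: mul_lin. Qed.

Lemma regulus_plane_scale t a b : t != 0 ->
  regulus_plane J (t * a, t * b) = regulus_plane J (a, b).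
Proof.
move=> t0; have it0 : iota t != 0 by rewrite fmorph_eq0.
apply/vspaceP => y; apply/idP/idP => /regulus_planeP[x ->];
  apply/regulus_planeP; rewrite /= ?rmorphM.
  by exists (iota t * x); congr J;
    rewrite mulrAC mulrC mulrA ?[_ * iota t]mulrC; ring.
by exists (x / iota t); congr J; field.
Qed.

Lemma base_regulusE : base_regulus J = [set regulus_plane J (proj_pt t) | t :
  option F].
Proof.
apply/setP => X; apply/imsetP/imsetP => -[]; last first.
  by move=> t _ ->; exists (proj_pt t); rewrite ?inE ?proj_pt_neq0.
case=> a b; rewrite inE xpair_eqE => ab0 ->.
have [b0|b0] := eqVneq b 0; last first.
  by exists (Some (a / b)) => //=; rewrite -[RHS](regulus_plane_scale _ _ b0)
    mulrC divfK // mulr1.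
exists None => //=; rewrite b0 in ab0 *; rewrite eqxx andbT in ab0.
by rewrite -[in RHS](regulus_plane_scale _ _ ab0) mulr1 mulr0.
Qed.

Lemma regulus_plane_meet t t' x : x != 0 ->
  J (cx t * x) (cy t * x) \in regulus_plane J (proj_pt t') ->
  t = t'.
Proof.
move=> x0 /regulus_planeP[z /(field_reduction_inj J_red)[e1 e2]].
apply: proj_pt_inj; apply: (fmorph_inj iota); rewrite !rmorphM;
  apply: (mulIf x0).
by rewrite /= mulrAC e1 [RHS]mulrAC e2; ring.
Qed.

Lemma regulus_plane_inj : injective (fun t => regulus_plane J (proj_pt t)).
Proof.
move=> t t' e; apply: (@regulus_plane_meet _ _ 1); rewrite ?oner_neq0 // -e.
by apply/regulus_planeP; exists 1.
Qed.

Lemma card_base_regulus : #|base_regulus J| = #|F|.+1.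
Proof. by rewrite base_regulusE card_imset ?card_option //;
  apply: regulus_plane_inj. Qed.

Lemma regulus_pt_neq0 ab x : ab != (0, 0) -> x != 0 ->
  J (iota ab.1 * x) (iota ab.2 * x) != 0.
Proof.
case: ab => a b; rewrite xpair_eqE negb_and /= => ab0 x0.
by apply: (field_reduction_neq0 J_red); rewrite !mulf_eq0 !fmorph_eq0 (negPf x0)
  !orbF.
Qed.

Lemma regulus_plane_dim ab : ab != (0, 0) -> \dim (regulus_plane J ab) = 3.
Proof.
move=> ab0; apply: dim_param (regulus_planeP ab) _ cardL => x y e.
apply/eqP; rewrite -subr_eq0; apply: contraTT isT => xy0.
case/eqP: (regulus_pt_neq0 ab0 xy0); rewrite !mulrBr.
by apply: (addIr (J (iota ab.1 * y) (iota ab.2 * y)));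
  rewrite -(field_reductionD J_red) !subrK add0r.
Qed.

(** In the tensor product of L and F^2 the planes of the regulus are the sets
    of pure tensors with a given second factor. If three pure tensors with
    pairwise independent second factors are dependent, then their first factors
    are proportional, and the line that they span consists of pure tensors with
    that same first factor. *)
Lemma base_regulus_is_2regulus : is_2regulus S (base_regulus J).
Proof.
have [_ _ inS] := J_red; split.
- exact: card_base_regulus.
- rewrite base_regulusE => _ /imsetP[t _ ->].
  split; first by rewrite regulus_plane_dim ?proj_pt_neq0.
  by apply/subvP => y /regulus_planeP[x ->].
- rewrite base_regulusE => _ _ /imsetP[t _ ->] /imsetP[t' _ ->] tt'.
  apply/eqP; apply: contraNT tt' =>
    /vpick_cap[y [y0 /regulus_planeP[x yE] yt']].
  apply/eqP; congr (regulus_plane J (proj_pt _)).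
  apply: (@regulus_plane_meet _ _ x); last by rewrite -yE.
  by apply: contraNneq y0 => x0; rewrite yE x0 !mulr0 (field_reduction0 J_red).
move=> l dim_l _; rewrite base_regulusE.
move=> _ _ _ /imsetP[t1 _ ->] /imsetP[t2 _ ->] /imsetP[t3 _ ->].
rewrite /= !inE negb_or andbT => /andP[/andP[n12 n13] n23].
case/vpick_cap => y1 [y10 y1l /regulus_planeP[x1 y1E]].
case/vpick_cap => y2 [y20 y2l /regulus_planeP[x2 y2E]].
case/vpick_cap => y3 [y30 y3l /regulus_planeP[x3 y3E]].
have nz t x : J (cx t * x) (cy t * x) != 0 -> x != 0.
  by apply: contraNneq => ->; rewrite !mulr0 (field_reduction0 J_red).
have x10 : x1 != 0 by apply: (nz t1); rewrite -y1E.
have x20 : x2 != 0 by apply: (nz t2); rewrite -y2E.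
have x30 : x3 != 0 by apply: (nz t3); rewrite -y3E.
have det_neq0 t t' : regulus_plane J (proj_pt t) != regulus_plane J
  (proj_pt t') ->
    cx t * cy t' - cy t * cx t' != 0.
  rewrite -!rmorphM -rmorphB fmorph_eq0 subr_eq0.
  by apply: contra_neq => /proj_pt_inj ->.
have [[d12 d13] d23] := (det_neq0 _ _ n12, det_neq0 _ _ n13, det_neq0 _ _ n23).
(* Elimination of one first factor from the two coordinates of a relation. *)
have y_free : free2 y1 y2.
  move=> a b; rewrite y1E y2E -!(field_reductionZ J_red)
    -(field_reductionD J_red).
  have [_ inj _] := J_red => /inj[e1 e2].
  have a0 : iota a * x1 = 0.
    apply: (mulfI d12); rewrite mulr0.
    transitivity (cy t2 * 0 - cx t2 * 0); last by ring.
    by rewrite -{1}e1 -e2; ring.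
  have b0 : iota b * x2 = 0.
    apply: (mulfI d12); rewrite mulr0.
    transitivity (cx t1 * 0 - cy t1 * 0); last by ring.
    by rewrite -{1}e2 -e1; ring.
  move: a0 b0 => /eqP + /eqP; rewrite !mulf_eq0 !fmorph_eq0 (negPf x10)
    (negPf x20) !orbF.
  by move=> /eqP-> /eqP->.
have lE := dim2_vline2 dim_l y_free y1l y2l.
have lP := mem_vline2 y1 y2; rewrite -lE in lP.
have /lP[[a b] /= y3ab] := y3l.
move: (y3ab); rewrite y1E y2E y3E -!(field_reductionZ J_red)
  -(field_reductionD J_red).
case/(field_reduction_inj J_red) => e1 e2.
(* The third first factor x3 is eliminated, and the determinants d13 and d23
   give x2 as an F-multiple of x1. *)
have rel : x2 * (iota b * (cx t2 * cy t3 - cy t2 * cx t3))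
    = - (iota a * x1 * (cx t1 * cy t3 - cy t1 * cx t3)).
  apply/eqP; rewrite -subr_eq0; apply/eqP.
  transitivity (cy t3 * (cx t3 * x3) - cx t3 * (cy t3 * x3)); last by ring.
  by rewrite e1 e2; ring.
have b0 : b != 0.
  apply: contraNneq y30 => b0; move/eqP: rel; rewrite b0 rmorph0 mul0r mulr0
    eq_sym oppr_eq0 mulf_eq0 (negPf d13) orbF.
  by rewrite mulf_eq0 fmorph_eq0 (negPf x10) orbF y3ab b0 scale0r addr0 =>
    /eqP->; rewrite scale0r.
have [r rE] : exists r, x2 = iota r * x1.
  exists (- (a * ((proj_pt t1).1 * (proj_pt t3).2 - (proj_pt t1).2 *
    (proj_pt t3).1)
     / (b * ((proj_pt t2).1 * (proj_pt t3).2 - (proj_pt t2).2 *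
       (proj_pt t3).1)))).
  rewrite rmorphN !(rmorphM iota) fmorphV !(rmorphM iota) !(rmorphB iota)
    !(rmorphM iota).
  have ib0 : iota b != 0 by rewrite fmorph_eq0.
  rewrite -[LHS](mulfK (mulf_neq0 ib0 d23)) rel.
  by field; rewrite d23 ib0.
have r0 : r != 0.
  by apply: contraNneq x20 => r0; rewrite rE r0 rmorph0 mul0r.
move=> _ /imsetP[t _ ->].
apply: (@cap_neq0 _ _ _ _ (J (cx t * x1) (cy t * x1))).
- by rewrite regulus_pt_neq0 ?proj_pt_neq0.
- apply/lP; move: d12; rewrite y1E y2E rE.
  case: (proj_pt t1) (proj_pt t2) (proj_pt t) => a1 b1 [a2 b2] [g h] /= d12.
  have ir0 : iota r != 0 by rewrite fmorph_eq0.
  exists ((g * b2 - h * a2) / (a1 * b2 - b1 * a2),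
          (a1 * h - b1 * g) / (a1 * b2 - b1 * a2) / r) => /=.
  rewrite -!(field_reductionZ J_red) -(field_reductionD J_red).
  rewrite !(fmorphV, rmorphM iota, rmorphB iota).
  by congr J; field; rewrite d12 ir0.
by apply/regulus_planeP; exists x1.
Qed.

End BaseRegulus.
End Reguli.

(** * The reguli contained in the splash *)

(** Norms of a + u and a + v that agree for all a in F are cubic polynomials
    whose difference has degree at most 2 and #|F| > 2 roots. So - u is a root
    of the norm of X + v. *)
Lemma norm3_translates (F L : finFieldType) (iota : {rmorphism F -> L})
  (u v : L) :
  (2 < #|F|)%N ->
  (forall a, norm3 iota (iota a + u) = norm3 iota (iota a + v)) ->
  [\/ u = v, u = frob iota v | u = frob iota (frob iota v)].
Proof.
move=> q_gt2 Nuv; set sg := frob iota.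
pose e1 x := x + sg x + sg (sg x); pose e2 x := x * sg x + x * sg (sg x) + sg x
  * sg (sg x).
pose p := Poly [:: norm3 iota u - norm3 iota v; e2 u - e2 v; e1 u - e1 v].
have pE x : p.[x] = (x + u) * (x + sg u) * (x + sg (sg u))
    - (x + v) * (x + sg v) * (x + sg (sg v)).
  by rewrite horner_Poly /= /e1 /e2 /norm3 -/sg; ring.
have p_root a : root p (iota a).
  rewrite rootE pE subr_eq0; have := Nuv a.
  by rewrite /norm3 !frobD !frob_iota -/sg => ->.
have p0 : p = 0.
  apply: contraTeq q_gt2 => p0; rewrite -leqNgt -ltnS.
  apply: leq_trans (size_Poly [:: norm3 iota u - norm3 iota v; e2 u - e2 v;
    e1 u - e1 v]).
  rewrite cardT -(size_map iota); apply: max_poly_roots p0 _ _.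
    by apply/allP => _ /mapP[a _ ->].
  by rewrite map_inj_uniq ?enum_uniq //; apply: fmorph_inj.
have /eqP := pE (- u); rewrite p0 horner0 addNr !mul0r sub0r eq_sym oppr_eq0.
rewrite !mulf_eq0 -orbA => /or3P[] /eqP; rewrite addrC => /subr0_eq.
- by constructor 1.
- by constructor 2.
by constructor 3.
Qed.

Section SpreadReguli.
Variables (F L : finFieldType) (iota : {rmorphism F -> L}).
Hypothesis cardL : #|L| = (#|F| ^ 3)%N.
Variables (n : nat) (S : subspace F n) (J : L -> L -> 'cV[F]_n).
Local Notation sg := (frob iota).
Local Notation field_reduction := (field_reduction iota S).
Local Notation spread_plane := (spread_plane iota J).
Local Notation spread_planes := (spread_planes iota J).
Local Notation indep := (indep iota).
Local Notation F_line := (F_line iota).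
Hypothesis J_red : field_reduction J.

Definition base_change (al be ga de : L) x y := J (al * x + be * y)
  (ga * x + de * y).

Lemma base_change_field_reduction al be ga de : al * de - be * ga != 0 ->
  field_reduction (base_change al be ga de).
Proof.
have [lin inj inS] := J_red; move=> det0;
  split=> [a x y x' y'|x y /inj[e1 e2]|x y].
- by rewrite -lin /base_change; congr J; ring.
- split; apply: (mulfI det0); rewrite mulr0.
    by transitivity (de * 0 - be * 0); [rewrite -{1}e1 -e2|]; ring.
  by transitivity (al * 0 - ga * 0); [rewrite -{1}e2 -e1|]; ring.
exact: inS.
Qed.

Section BaseChange.
Variables al be ga de : L.
Hypothesis det0 : al * de - be * ga != 0.
Local Notation J' := (base_change al be ga de).
Let J'_red := base_change_field_reduction det0.

Lemma regulus_plane_base_change a b s z : z != 0 ->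
  iota a * al + iota b * be = s * z -> iota a * ga + iota b * de = sg s * z ->
  regulus_plane iota J' (a, b) = spread_plane s.
Proof.
move=> z0 e1 e2; apply/vspaceP => y; apply/idP/idP.
  case/(regulus_planeP J'_red) => x ->; apply/(spread_planeP J_red).
  by exists (z * x); rewrite !mulrA -e1 -e2 /base_change; congr J; ring.
case/(spread_planeP J_red) => x ->; apply/(regulus_planeP J'_red).
exists (x / z); rewrite /base_change /=; congr J.
  transitivity ((iota a * al + iota b * be) * (x / z)); last by ring.
  by rewrite e1; field.
transitivity ((iota a * ga + iota b * de) * (x / z)); last by ring.
by rewrite e2; field.
Qed.

Lemma base_change_comb_neq0 a b : (a, b) != (0, 0) ->
  (iota a * al + iota b * be != 0) || (iota a * ga + iota b * de != 0).
Proof.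
move=> ab0; have := regulus_pt_neq0 J'_red ab0 (oner_neq0 L).
rewrite !mulr1 /base_change -negb_and; apply: contraNN => /andP[/eqP e1 /eqP e2]
  /=.
by rewrite [al * _]mulrC [be * _]mulrC e1 [ga * _]mulrC [de * _]mulrC e2
  (field_reduction0 J_red).
Qed.

(** The map g is the identity for pencils, and the inverse for the images of
    pencils under the exchange of coordinates. *)
Lemma base_regulus_base_change (e f : L) (g : L -> L) : indep e f ->
  (forall a b (s := iota a * e + iota b * f), s != 0 -> exists z, [/\ z != 0,
     iota a * al + iota b * be = g s * z & iota a * ga + iota b * de = sg (g s)
       * z]) ->
  base_regulus iota J' = [set spread_plane (g s) | s in F_line e f].
Proof.
move=> ef gP; apply/setP => Y; apply/imsetP/imsetP =>
  [[[a b]]|[s /F_lineP[s0 [a [b sE]]] ->]].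
  rewrite inE => ab0 ->; have s0 : iota a * e + iota b * f != 0.
    by apply: contraNneq ab0 => /ef[-> ->].
  exists (iota a * e + iota b * f); first by apply/F_lineP; split=> //;
    exists a, b.
  by have [z [z0 e1 e2]] := gP a b s0; apply: regulus_plane_base_change z0 e1
    e2.
exists (a, b).
  by rewrite inE; apply: contraNneq s0 => -[a0 b0];
    rewrite sE a0 b0 rmorph0 !mul0r addr0.
rewrite sE in s0 *.
by have [z [z0 e1 e2]] := gP a b s0;
  rewrite (regulus_plane_base_change z0 e1 e2).
Qed.

End BaseChange.

Lemma pencil_is_2regulus e f : indep e f -> is_2regulus S
  (spread_planes (F_line e f)).
Proof.
move=> ef; have det0 := indep_det ef.
have -> : spread_planes (F_line e f) = base_regulus iota
  (base_change e f (sg e) (sg f)).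
  apply/esym/(base_regulus_base_change det0 (g := id) ef) => a b s s0.
  exists 1; rewrite oner_neq0 !mulr1; split=> //.
  by rewrite /s frobD !frobM !frob_iota.
exact: base_regulus_is_2regulus (base_change_field_reduction det0).
Qed.

(** Two points (s, s^q) and (s', s'^q) are equal exactly when s / s' is in F. *)
Lemma spread_plane_neq_det s s' : s != 0 -> s' != 0 -> spread_plane s !=
  spread_plane s' ->
  s * sg s' - s' * sg s != 0.
Proof.
move=> s0 s'0; apply: contraNneq => /subr0_eq e; apply/eqP.
have ss'0 : sg s' != 0 by rewrite fmorph_eq0.
have [a aE] : exists a, s / s' = iota a.
  apply: frob_fix; rewrite frobM frobV; apply: (mulIf ss'0); rewrite divfK //.
  by rewrite mulrAC e mulrAC mulfV ?mul1r.
rewrite -(divfK s'0 s) aE (spread_plane_scale J_red) //.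
by rewrite -(fmorph_eq0 iota) -aE mulf_neq0 ?invr_eq0.
Qed.

Variables (tau : L) (tau_prim : (#|L|.-1).-primitive_root tau).

(** Three planes X, Y, Z of the regulus give coordinates of L x L in which they
    are the planes (1, 0), (0, 1), (1, 1) of the base regulus. A line meeting
    the three meets the other planes too, in points of the base regulus. *)
Lemma regulus_in_spread R : is_2regulus S R -> (1 < #|F|)%N ->
  (forall Y, Y \in R -> exists2 s, s != 0 & Y = spread_plane s) ->
  exists al be ga de, [/\ al * de - be * ga != 0, al != 0, norm3 iota al = norm3
    iota ga &
    R = base_regulus iota (base_change al be ga de)].
Proof.
case=> cardR _ _ transversal q_gt1 R_spread.
have /card_gt2P[X [Y [Z [[XR YR ZR] [XY YZ ZX]]]]] : (2 < #|R|)%N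
  by rewrite cardR.
have [[s0 s00 XE] [s1 s10 YE] [s2 s20 ZE]] := And3 (R_spread _ XR)
  (R_spread _ YR) (R_spread _ ZR).
have d01 : s0 * sg s1 - s1 * sg s0 != 0 by apply: spread_plane_neq_det;
  rewrite -?XE -?YE.
have d12 : s1 * sg s2 - s2 * sg s1 != 0 by apply: spread_plane_neq_det;
  rewrite -?YE -?ZE.
have d20 : s2 * sg s0 - s0 * sg s2 != 0 by apply: spread_plane_neq_det;
  rewrite -?ZE -?XE.
have [la [mu [la0 mu0 comb scomb]]] : exists la mu, [/\ la != 0, mu != 0,
    la * s0 + mu * s1 = s2 & la * sg s0 + mu * sg s1 = sg s2].
  exists ((s2 * sg s1 - s1 * sg s2) / (s0 * sg s1 - s1 * sg s0)).
  exists ((s0 * sg s2 - s2 * sg s0) / (s0 * sg s1 - s1 * sg s0)).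
  by split; rewrite ?mulf_neq0 ?invr_eq0 //;
    [rewrite -opprB oppr_eq0|rewrite -opprB oppr_eq0|field|field].
pose al := la * s0; pose be := mu * s1; pose ga := la * sg s0;
  pose de := mu * sg s1.
have det0 : al * de - be * ga != 0.
  have -> : al * de - be * ga = la * mu * (s0 * sg s1 - s1 * sg s0).
    by rewrite /al /be /ga /de; ring.
  by rewrite !mulf_neq0.
have J'_red := base_change_field_reduction det0; set J' := base_change al be ga
  de in J'_red *.
have XE' : X = regulus_plane iota J' (1, 0).
  by rewrite XE; apply/esym/(regulus_plane_base_change det0 la0);
    rewrite rmorph0 rmorph1 /al /ga; ring.
have YE' : Y = regulus_plane iota J' (0, 1).
  by rewrite YE; apply/esym/(regulus_plane_base_change det0 mu0);
    rewrite rmorph0 rmorph1 /be /de; ring.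
have ZE' : Z = regulus_plane iota J' (1, 1).
  rewrite ZE; apply/esym/(regulus_plane_base_change det0 (oner_neq0 L));
    by rewrite rmorph1 !mul1r mulr1.
have sub : R \subset base_regulus iota J'.
  apply/subsetP => W WR; have [s _ WE] := R_spread _ WR.
  pose y1 := J' 1 0; pose y2 := J' 0 1.
  have yE a b : a *: y1 + b *: y2 = J' (iota a * 1) (iota b * 1).
    rewrite -!(field_reductionZ J'_red) -(field_reductionD J'_red).
    by rewrite !mulr0 addr0 add0r.
  have y_free : free2 y1 y2.
    move=> a b; rewrite yE !mulr1; have [_ inj _] := J'_red =>
      /inj[/eqP + /eqP].
    by rewrite !fmorph_eq0 => /eqP-> /eqP->.
  have l_pt ab : J' (iota ab.1 * 1) (iota ab.2 * 1) \in (<[y1]> + <[y2]>)%VS.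
    by apply/mem_vline2; exists ab; rewrite yE.
  have l_meet ab : ab != (0, 0) -> ((<[y1]> + <[y2]>) :&: regulus_plane iota J'
    ab != 0)%VS.
    move=> ab0; apply: (cap_neq0 (regulus_pt_neq0 J'_red ab0 (oner_neq0 L))
      (l_pt ab)).
    by apply/(regulus_planeP J'_red); exists 1.
  have lS : (<[y1]> + <[y2]> <= S)%VS.
    by have [_ _ inS] := J'_red; apply/subvP => y /mem_vline2[[a b] ->];
      rewrite yE.
  have := transversal _ (dim_vline2 y_free) lS X Y Z XR YR ZR.
  rewrite /= !inE negb_or XY YZ (eq_sym X) ZX => /(_ isT).
  rewrite XE' YE' ZE' !l_meet ?xpair_eqE ?oner_eq0 ?andbF // =>
    /(_ isT isT isT W WR).
  case/vpick_cap => y [y0 /mem_vline2[[a b] /= yab]]; rewrite yab yE WE.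
  case/(spread_planeP J_red) => z /(field_reduction_inj J_red)[e1 e2].
  have ab0 : (a, b) != (0, 0).
    by apply: contraNneq y0 => -[a0 b0]; rewrite yab a0 b0 !scale0r addr0.
  have z0 : z != 0.
    have := base_change_comb_neq0 det0 ab0; apply: contraTneq => z0.
    move: e1 e2; rewrite z0 !mulr0 !mulr1 mulrC [be * _]mulrC => ->.
    by rewrite mulrC [de * _]mulrC => ->; rewrite eqxx.
  apply/imsetP; exists (a, b); first by rewrite inE.
  apply/esym/(regulus_plane_base_change det0 z0).
    by rewrite -e1; ring.
  by rewrite -e2; ring.
exists al, be, ga, de; split=> //.
- by rewrite mulf_neq0.
- by rewrite /al /ga !norm3M norm3_frob.
by apply/eqP; rewrite eqEcard sub cardR (card_base_regulus J'_red) leqnn.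
Qed.

(** The points (a al + b be, a ga + b de) are multiples of (s, s^q), so that
    their coordinates have the same norm; with u = be / al and v = de / ga
    this is the case of [norm3_translates]. The case u = v contradicts the
    independence of the coordinates. If v = u^q the points are the (s, s^q)
    with s = m (a + b u), where m is such that m^(q-1) = ga / al, and if
    u = v^q they are those with 1 / s = m (a + b v), m^(q-1) = al / ga. *)
Lemma regulus_in_spread_types R : is_2regulus S R -> (2 < #|F|)%N ->
  (forall Y, Y \in R -> exists2 s, s != 0 & Y = spread_plane s) ->
  exists e f, indep e f /\ (R = spread_planes (F_line e f) \/
    R = [set spread_plane s^-1 | s in F_line e f]).
Proof.
move=> R_reg q_gt2 R_spread.
have [al [be [ga [de [det0 al0 Nal RE]]]]] := regulus_in_spread R_reg
  (ltnW q_gt2) R_spread.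
have ga0 : ga != 0 by rewrite -(norm3_eq0 iota) -Nal norm3_eq0.
have J'_red := base_change_field_reduction det0.
have norms a b : (a, b) != (0, 0) ->
    norm3 iota (iota a * al + iota b * be) = norm3 iota
      (iota a * ga + iota b * de).
  move=> ab0; have : regulus_plane iota (base_change al be ga de) (a, b) \in R.
    by rewrite RE; apply: imset_f; rewrite inE.
  case/R_spread => s s0 abE.
  have : base_change al be ga de (iota a * 1) (iota b * 1) \in spread_plane s.
    by rewrite -abE; apply/(regulus_planeP J'_red); exists 1.
  case/(spread_planeP J_red) => z /(field_reduction_inj J_red)[].
  rewrite !mulr1 [al * _]mulrC [be * _]mulrC [ga * _]mulrC
    [de * _]mulrC => -> ->.
  by rewrite !norm3M norm3_frob.
have [u beE] : exists u, be = al * u by exists (be / al); field.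
have [v deE] : exists v, de = ga * v by exists (de / ga); field.
have uv : u != v.
  by apply: contraNneq det0 => uv; rewrite beE deE uv; apply/eqP; ring.
have Nuv a : norm3 iota (iota a + u) = norm3 iota (iota a + v).
  have Nal0 : norm3 iota al != 0 by rewrite norm3_eq0.
  apply: (mulfI Nal0); rewrite {2}Nal -!norm3M !mulrDr -beE -deE.
  by rewrite ![_ * iota a]mulrC -[be]mul1r -[de]mul1r -(rmorph1 iota) norms //
    xpair_eqE oner_eq0 andbF.
have indep1 w m : sg w != w -> m != 0 -> indep m (m * w).
  move=> w_notF m0; rewrite -[X in indep X](mulr1 m); apply: indep_scale m0 _ =>
    a b.
  rewrite mulr1; have [-> /eqP|b0 abw] := eqVneq b 0.
    by rewrite rmorph0 mul0r addr0 fmorph_eq0 => /eqP.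
  have ib0 : iota b != 0 by rewrite fmorph_eq0.
  have wE : w = iota (- (a / b)).
    rewrite rmorphN rmorphM fmorphV; apply: (mulfI ib0).
    by apply/eqP; rewrite -subr_eq0; apply/eqP; rewrite -abw; field.
  by case/eqP: w_notF; rewrite wE frob_iota.
have Nal0 : norm3 iota al != 0 by rewrite norm3_eq0.
case: (norm3_translates q_gt2 Nuv) uv => [->|uE|uE]; first by rewrite eqxx.
  rewrite uE => v_notF.
  have Nk : norm3 iota (al / ga) = 1 by rewrite norm3M norm3V -Nal divff.
  have [m m0 mE] := hilbert90 cardL tau_prim Nk.
  exists m, (m * v); split; [exact: indep1 | right].
  rewrite RE; apply: (base_regulus_base_change det0 (indep1 _ _ v_notF m0)) =>
    a b s s0.
  have sE : s = m * (iota a + iota b * v) by rewrite /s; ring.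
  have abv0 : iota a + iota b * v != 0 by apply: contraNneq s0;
    rewrite sE => ->; rewrite mulr0.
  have sabv : sg (iota a + iota b * v) = iota a + iota b * u.
    by rewrite frobD frobM !frob_iota uE.
  have abu0 : iota a + iota b * u != 0 by rewrite -sabv fmorph_eq0.
  exists (al * (iota a + iota b * u) * s); split; first by rewrite !mulf_neq0.
    by rewrite beE; field.
  by rewrite frobV sE frobM sabv mE deE; field; rewrite al0 ga0 abu0 m0.
have vE : v = sg u by rewrite uE (frob3 _ cardL).
rewrite vE eq_sym => u_notF.
have Nk : norm3 iota (ga / al) = 1 by rewrite norm3M norm3V -Nal divff.
have [m m0 mE] := hilbert90 cardL tau_prim Nk.
exists m, (m * u); split; [exact: indep1 | left].
rewrite RE; apply: (base_regulus_base_change det0 (g := id)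
  (indep1 _ _ u_notF m0)) => a b s s0.
have sE : s = m * (iota a + iota b * u) by rewrite /s; ring.
exists (al / m); split; first by rewrite mulf_neq0 ?invr_eq0.
  by rewrite sE beE; field.
by rewrite sE frobM frobD frobM !frob_iota -vE mE deE; field; rewrite al0 m0.
Qed.

End SpreadReguli.

(** * Exchanging the two coordinates *)

Section CoverTheorem.
Variables (F L : finFieldType) (iota : {rmorphism F -> L}).
Hypothesis cardL : #|L| = (#|F| ^ 3)%N.
Variables (tau : L) (tau_prim : (#|L|.-1).-primitive_root tau).
Variables (n : nat) (S : subspace F n).
Local Notation sg := (frob iota).
Local Notation field_reduction := (field_reduction iota S).
Local Notation indep := (indep iota).
Local Notation F_line := (F_line iota).
Implicit Types (J : L -> L -> 'cV[F]_n).

Definition cover J r : {set subspace F n} :=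
  [set cover_of iota J r k | k in norm1 F L].

Lemma in_norm1 k : (k \in norm1 F L) = (norm3 iota k == 1).
Proof. by rewrite inE norm3E. Qed.

Lemma norm1_neq0 k : k \in norm1 F L -> k != 0.
Proof. by rewrite in_norm1 -(norm3_eq0 iota) => /eqP->; apply: oner_neq0. Qed.

Lemma spread_plane_swap J s : field_reduction J -> s != 0 ->
  spread_plane iota (swap J) s = spread_plane iota J s^-1.
Proof.
move=> J_red s0; have J'_red := swap_field_reduction J_red.
have ss0 : sg s != 0 by rewrite fmorph_eq0.
apply/vspaceP => y; apply/idP/idP.
  case/(spread_planeP J'_red) => x ->; apply/(spread_planeP J_red).
  by exists (s * sg s * x); rewrite /swap frobV; congr J; field.
case/(spread_planeP J_red) => x ->; apply/(spread_planeP J'_red).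
by exists (x / (s * sg s)); rewrite /swap frobV; congr J; field; rewrite ss0 s0.
Qed.

Lemma spread_planes_swap J e f : field_reduction J ->
  spread_planes iota (swap J) (F_line e f) =
  [set spread_plane iota J s^-1 | s in F_line e f].
Proof.
by move=> J_red; apply: eq_in_imset => s /F_line_neq0; apply: spread_plane_swap.
Qed.

(** With y = (k x)^q the point (x^q, k x) is (y / k^q, y^(q^2)). *)
Lemma cover_of_swap1 J k : field_reduction J -> k != 0 ->
  cover_of iota (swap J) 1 k = cover_of iota J 2 (sg k)^-1.
Proof.
move=> J_red k0; have J'_red := swap_field_reduction J_red.
have sk0 : sg k != 0 by rewrite fmorph_eq0.
apply/vspaceP => y; apply/idP/idP.
  case/(cover_ofP J'_red) => x ->; apply/(cover_ofP J_red).
  by exists (sg (k * x)); rewrite /swap /= frob3 // frobM mulKf.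
case/(cover_ofP J_red) => x ->; apply/(cover_ofP J'_red).
exists (k^-1 * sg (sg x)); rewrite /swap /= frobM frobV frob3 //.
by rewrite mulVKf.
Qed.

Lemma cover_of_swap2 J k : field_reduction J -> k != 0 ->
  cover_of iota (swap J) 2 k = cover_of iota J 1 (sg (sg k))^-1.
Proof.
move=> J_red k0; have J'_red := swap_field_reduction J_red.
have sk0 : sg (sg k) != 0 by rewrite !fmorph_eq0.
apply/vspaceP => y; apply/idP/idP.
  case/(cover_ofP J'_red) => x ->; apply/(cover_ofP J_red).
  by exists (sg (sg (k * x))); rewrite /swap /= frob3 // !frobM mulKf.
case/(cover_ofP J_red) => x ->; apply/(cover_ofP J'_red).
exists (k^-1 * sg x); rewrite /swap /= !(frobM, frobV) frob3 //.
by rewrite mulVKf.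
Qed.

Lemma norm1V k : k \in norm1 F L -> k^-1 \in norm1 F L.
Proof. by rewrite !in_norm1 norm3V => /eqP->; rewrite invr1. Qed.

Lemma norm1_frob k : k \in norm1 F L -> sg k \in norm1 F L.
Proof. by rewrite !in_norm1 norm3_frob. Qed.

Lemma cover_swap1 J : field_reduction J -> cover (swap J) 1 = cover J 2.
Proof.
move=> J_red; apply/setP => X; apply/imsetP/imsetP => -[k nk ->].
  exists (sg k)^-1; first exact/norm1V/norm1_frob.
  by rewrite cover_of_swap1 ?norm1_neq0.
exists (sg (sg k))^-1; first exact/norm1V/norm1_frob/norm1_frob.
rewrite cover_of_swap1 ?norm1_neq0 //; last exact/norm1V/norm1_frob/norm1_frob.
by rewrite frobV frob3 // invrK.
Qed.

Lemma cover_swap2 J : field_reduction J -> cover (swap J) 2 = cover J 1.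
Proof.
move=> J_red; apply/setP => X; apply/imsetP/imsetP => -[k nk ->].
  exists (sg (sg k))^-1; first exact/norm1V/norm1_frob/norm1_frob.
  by rewrite cover_of_swap2 ?norm1_neq0.
exists (sg k)^-1; first exact/norm1V/norm1_frob.
rewrite cover_of_swap2 ?norm1_neq0 //; last exact/norm1V/norm1_frob.
by rewrite !frobV frob3 // invrK.
Qed.

Section OneMap.
Variable J : L -> L -> 'cV[F]_n.
Hypothesis J_red : field_reduction J.
Local Notation spread_planes := (spread_planes iota J).

Lemma pencil_meets_covers e f : indep e f ->
  [/\ is_2regulus S (spread_planes (F_line e f)),
      forall X, X \in cover J 1 -> meets_in_a_line (spread_planes (F_line e f))
        X,
      forall X Y l, X \in cover J 1 -> Y \in cover J 1 ->
        meets_in_the_line (spread_planes (F_line e f)) X l ->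
        meets_in_the_line (spread_planes (F_line e f)) Y l -> X = Y &
      forall X, X \in cover J 2 -> meets_in_a_conic (spread_planes (F_line e f))
        X].
Proof.
move=> ef; split.
- exact: (pencil_is_2regulus cardL J_red).
- move=> X /imsetP[k]; rewrite in_norm1 => /eqP nk ->.
  exact: (pencil_meets_tangent cardL J_red tau_prim).
- move=> _ _ l /imsetP[k _ ->] /imsetP[k' _ ->] Xl Yl.
  by rewrite (cover_lines_distinct J_red Xl Yl).
move=> X /imsetP[k]; rewrite in_norm1 => /eqP nk ->.
exact: (pencil_meets_conic cardL J_red tau_prim).
Qed.

Variable Z : {set L}.
Hypothesis Z_neq0 : forall s, s \in Z -> s != 0.

Lemma line_section_is_pencil (X : subspace F n) : X \in cover J 1 ->
  meets_in_a_line (spread_planes Z) X ->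
  exists e f, indep e f /\ spread_planes Z = spread_planes (F_line e f).
Proof.
case/imsetP => k; rewrite in_norm1 => /eqP nk ->.
exact: (line_in_tangent_pencil cardL J_red tau_prim).
Qed.

(** A regulus of the splash that is not a pencil is one for the swapped
    coordinates, and then it meets the planes of the second cover in lines. *)
Lemma conic_section_is_pencil (X : subspace F n) : is_2regulus S
  (spread_planes Z) -> (2 < #|F|)%N ->
  X \in cover J 2 -> meets_in_a_conic (spread_planes Z) X ->
  exists e f, indep e f /\ spread_planes Z = spread_planes (F_line e f).
Proof.
move=> Z_reg q_gt2 X_cover X_conic.
have [|e [f [ef [ZE|ZE]]]] := regulus_in_spread_types cardL J_red tau_prim Z_reg
  q_gt2.
- by move=> _ /imsetP[s Zs ->]; exists s; rewrite ?Z_neq0.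
- by exists e, f.
have J'_red := swap_field_reduction J_red.
rewrite ZE -spread_planes_swap // in X_conic.
rewrite -cover_swap1 // in X_cover; case/imsetP: X_cover X_conic => k.
rewrite in_norm1 => /eqP nk -> /line_section_is_not_conic [].
exact: (pencil_meets_tangent cardL J'_red tau_prim ef nk).
Qed.

End OneMap.
End CoverTheorem.

(** * Coordinates of lines of a subplane as elements of the cubic field *)

Section Dot.
Variable R : comNzRingType.
Implicit Types u v : 'cV[R]_3.

Definition dot u v : R := \sum_i u i 0 * v i 0.

Lemma mulmx_dot u v : u^T *m v = (dot u v)%:M.
Proof.
apply/matrixP => i j; rewrite !ord1 !mxE eqxx mulr1n.
by apply: eq_bigr => k _; rewrite mxE.
Qed.

Lemma dotC u v : dot u v = dot v u.
Proof. by apply: eq_bigr => i _; rewrite mulrC. Qed.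

Lemma dotDr u v v' : dot u (v + v') = dot u v + dot u v'.
Proof. by rewrite -big_split; apply: eq_bigr => i _; rewrite mxE mulrDr. Qed.

Lemma dotZr a u v : dot u (a *: v) = a * dot u v.
Proof. by rewrite big_distrr; apply: eq_bigr => i _; rewrite mxE mulrCA. Qed.

Lemma dot_delta u i : dot u (delta_mx i 0) = u i 0.
Proof.
rewrite /dot (bigD1 i) //= big1 => [|j /negPf ij].
  by rewrite mxE !eqxx mulr1 addr0.
by rewrite mxE ij mulr0.
Qed.

Lemma dot_mulmx (M : 'M[R]_3) u v : dot (M^T *m u) v = dot u (M *m v).
Proof.
have := congr1 (fun A : 'M[R]_1 => A 0 0) (mulmxA u^T M v).
rewrite -[u^T *m M]trmxK trmx_mul trmxK !mulmx_dot.
by rewrite !mxE eqxx !mulr1n.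
Qed.

Lemma dot_col3 a b c a' b' c' :
  dot (col3 a b c) (col3 a' b' c') = a * a' + b * b' + c * c'.
Proof. by rewrite /dot !big_ord_recl big_ord0 !mxE /= addr0 addrA. Qed.

End Dot.

Lemma dot_map (R R' : comNzRingType) (f : {rmorphism R -> R'}) (u v : 'cV[R]_3)
  :
  dot (map_mx f u) (map_mx f v) = f (dot u v).
Proof. by rewrite rmorph_sum; apply: eq_bigr => i _; rewrite !mxE rmorphM. Qed.

Section LinesOfPlane.
Variable K : finFieldType.
Implicit Types u v : 'cV[K]_3.

Lemma mem_line_with_coords u v : (v \in line_with_coords u) = (dot u v == 0).
Proof.
rewrite memv_ker lfunE /= mulmx_dot.
by apply/eqP/eqP => [/matrixP/(_ 0 0)|->]; rewrite ?raddf0 // !mxE eqxx mulr1n.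
Qed.

Lemma dim_line_with_coords u : u != 0 -> \dim (line_with_coords u) = 2.
Proof.
move=> u0; have := limg_ker_dim (linfun (mulmx u^T : 'cV[K]_3 -> 'cV[K]_1))
  fullv.
rewrite capfv dimvf /dim /= muln1.
suff -> : \dim (limg (linfun (mulmx u^T : 'cV[K]_3 -> 'cV[K]_1))) = 1%N.
  by rewrite addn1 => -[].
apply/eqP; rewrite eqn_leq; apply/andP; split.
  by rewrite (leq_trans (dimvS (subvf _))) // dimvf /dim /= muln1.
rewrite lt0n dimv_eq0; have /cV0Pn[i ui0] := u0.
apply: contraNneq ui0 => im0.
have : linfun (mulmx u^T : 'cV[K]_3 -> 'cV[K]_1) (delta_mx i 0) \in 0%VS.
  by rewrite -im0 memv_img ?memvf.
by rewrite memv0 lfunE /= -colE => /eqP/matrixP/(_ 0 0); rewrite !mxE => ->.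
Qed.

Lemma orthogonal_to_two u1 u2 : exists2 v, v != 0 & dot v u1 = 0 /\ dot v u2 =
  0.
Proof.
pose W : 'M[K]_(3, 1 + 1) := row_mx u1 u2.
have W_ker : kermx W != 0.
  by rewrite kermx_eq0 neq_ltn ltnS (leq_trans (rank_leq_col _)).
exists (nz_row (kermx W))^T; first by rewrite -[0]trmx0 (inj_eq trmx_inj)
  nz_row_eq0.
have : nz_row (kermx W) *m W = 0 by apply/sub_kermxP/nz_row_sub.
rewrite mul_mx_row -[0]row_mx0 => /eq_row_mx[].
rewrite -{1 2}[nz_row _]trmxK !mulmx_dot => e1 e2.
split; [move/matrixP/(_ 0 0): e1 | move/matrixP/(_ 0 0): e2];
  by rewrite !mxE eqxx mulr1n.
Qed.

End LinesOfPlane.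

Lemma line_with_coords_basis (K : finFieldType) (v : 'cV[K]_3) : v != 0 ->
  exists u1 u2, free2 u1 u2 /\
    forall u, dot v u = 0 <-> exists ab : K * K, u = ab.1 *: u1 + ab.2 *: u2.
Proof.
move=> v0; have [u1 [u2 [u_free vE]]] := dim2_basis (dim_line_with_coords v0).
exists u1, u2; split=> // u; rewrite -mem_vline2 -vE mem_line_with_coords.
by split=> /eqP.
Qed.

Lemma line_with_coords_of_basis (K : finFieldType) (u1 u2 : 'cV[K]_3) :
  free2 u1 u2 -> exists2 v, v != 0 &
    forall u, dot v u = 0 <-> exists ab : K * K, u = ab.1 *: u1 + ab.2 *: u2.
Proof.
move=> u_free; have [v v0 [vu1 vu2]] := orthogonal_to_two u1 u2.
exists v => // u; rewrite -mem_vline2.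
rewrite -(dim2_vline2 (dim_line_with_coords v0)) ?mem_line_with_coords ?vu1 ?vu2
  //.
by split=> /eqP.
Qed.

Section CubicCoordinates.
Variables (F L : finFieldType) (iota : {rmorphism F -> L}).
Hypothesis cardL : #|L| = (#|F| ^ 3)%N.
Variables (tau : L) (tau_prim : (#|L|.-1).-primitive_root tau).
Local Notation sg := (frob iota).

Lemma frob_primitive_neq : sg tau != tau.
Proof.
have q_gt1 := finNzRing_gt1 F.
have q_lt : (#|F| < #|L|.-1)%N.
  rewrite cardL -ltnS prednK ?expn_gt0 ?(ltnW q_gt1) //.
  apply: leq_trans (_ : #|F| ^ 2 < _)%N; last by rewrite ltn_exp2l.
  by rewrite ltnS expnS expn1 -{1}[#|F|]muln1 ltn_mul2l q_gt1 (ltnW q_gt1).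
rewrite /frob -{2}[tau]expr1 (eq_prim_root_expr tau_prim) !modn_small
  ?(leq_ltn_trans _ q_lt) //.
  by rewrite neq_ltn q_gt1 orbT.
exact: ltnW.
Qed.

Lemma tau_diffs : [/\ tau - sg tau != 0, tau - sg (sg tau) != 0 & sg tau - sg
  (sg tau) != 0].
Proof.
have t1 := frob_primitive_neq.
have t2 : sg (sg tau) != tau by apply: contra_neq t1 => /(frob2_fix cardL).
rewrite !subr_eq0; split; rewrite eq_sym //.
by rewrite (inj_eq (fmorph_inj sg)).
Qed.

(** The element of L with coordinates u, which is also the value at
    (1, tau, tau^2) of the line with coordinates u. *)
Definition cubic_elt (u : 'cV[F]_3) : L := \sum_(i < 3) iota (u i 0) * tau ^+ i.

Definition tau_pt : 'cV[L]_3 := col3 1 tau (tau ^+ 2).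

Lemma dot_tau_pt u : dot (map_mx iota u) tau_pt = cubic_elt u.
Proof.
rewrite [u]col3E /cubic_elt /dot !big_ord_recl !big_ord0 !mxE /=.
by rewrite expr0 expr1.
Qed.

(** By Lagrange interpolation at the conjugates of tau: this is the row of
    coefficients of (X - tau')(X - tau'') / ((tau - tau') (tau - tau'')). *)
Definition tau_dual : 'cV[L]_3 :=
  ((tau - sg tau) * (tau - sg (sg tau)))^-1 *:
  col3 (sg tau * sg (sg tau)) (- sg tau - sg (sg tau)) 1.

Lemma cubic_elt_dual u :
  map_mx iota u = cubic_elt u *: tau_dual + sg (cubic_elt u) *: map_mx sg
    tau_dual
    + sg (sg (cubic_elt u)) *: map_mx sg (map_mx sg tau_dual).
Proof.
have [d1 d2 d3] := tau_diffs.
have d1' : sg tau - tau != 0 by rewrite -opprB oppr_eq0.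
have d2' : sg (sg tau) - tau != 0 by rewrite -opprB oppr_eq0.
have d3' : sg (sg tau) - sg tau != 0 by rewrite -opprB oppr_eq0.
have sE : cubic_elt u = iota (u 0 0) + iota (u 1 0) * tau + iota (u (1 + 1) 0) *
  tau ^+ 2.
  by rewrite -dot_tau_pt [in LHS](col3E u) /dot !big_ord_recl !big_ord0 !mxE /=
    mulr1 addr0 addrA.
have ssE : sg (cubic_elt u) = iota (u 0 0) + iota (u 1 0) * sg tau + iota
  (u (1 + 1) 0) * sg tau ^+ 2.
  by rewrite sE !frobD !frobM !frob_iota.
have sssE : sg (sg (cubic_elt u)) = iota (u 0 0) + iota (u 1 0) * sg (sg tau) +
  iota (u (1 + 1) 0) * sg (sg tau) ^+ 2.
  by rewrite ssE !frobD !frobM !frob_iota.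
rewrite sssE ssE sE [in LHS](col3E u).
move: (u 0 0) (u 1 0) (u (1 + 1) 0) => a b c.
have s1 : sg 1 = 1 by apply: rmorph1.
have sN x : sg (- x) = - sg x by apply: rmorphN.
apply/colP => -[[|[|[|i]]] lti] //;
  rewrite !mxE /= ?(frobM, frobV, frobD, sN, s1, frob3 iota cardL)
    ?(frobM, frobV, frobD, sN, s1, frob3 iota cardL);
  field; by rewrite ?d1 ?d2 ?d3 ?d1' ?d2' ?d3'.
Qed.

Lemma cubic_elt_comb a b u v :
  cubic_elt (a *: u + b *: v) = iota a * cubic_elt u + iota b * cubic_elt v.
Proof.
rewrite /cubic_elt !big_distrr -big_split; apply: eq_bigr => i _ /=.
by rewrite !mxE rmorphD !rmorphM mulrDl !mulrA.
Qed.

Lemma cubic_eltB u v : cubic_elt (u - v) = cubic_elt u - cubic_elt v.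
Proof.
have := cubic_elt_comb 1 (-1) u v.
by rewrite scale1r scaleN1r rmorphN rmorph1 mul1r mulN1r.
Qed.

Lemma cubic_elt_eq0 u : (cubic_elt u == 0) = (u == 0).
Proof.
apply/eqP/eqP => [s0|->]; last by rewrite -(subrr 0) cubic_eltB subrr.
apply: (@map_mx_inj _ _ iota); rewrite cubic_elt_dual s0 !rmorph0 !scale0r
  !addr0.
by rewrite raddf0.
Qed.

Lemma cubic_elt_inj : injective cubic_elt.
Proof.
by move=> u v /eqP; rewrite -subr_eq0 -cubic_eltB cubic_elt_eq0 subr_eq0 =>
  /eqP.
Qed.

Lemma card_cubic_coords : #|{: 'cV[F]_3}| = #|L|.
Proof. by rewrite card_mx cardL. Qed.

Lemma cubic_elt_surj x : exists u, x = cubic_elt u.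
Proof.
have [|g _ gK] := inj_card_bij cubic_elt_inj;
  first by rewrite card_cubic_coords.
by exists (g x); rewrite gK.
Qed.

Lemma cubic_elt_coords x : cubic_elt (coords iota tau x) = x.
Proof.
rewrite /coords; case: pickP => [u /eqP->|] //=.
by have [u xE] := cubic_elt_surj x => /(_ u); rewrite xE eqxx.
Qed.

Lemma indep_cubic_elt u v : indep iota (cubic_elt u) (cubic_elt v) <->
  free2 u v.
Proof.
split=> uv_free a b.
  by move=> ab0; apply: uv_free; rewrite -cubic_elt_comb ab0; apply/eqP;
    rewrite cubic_elt_eq0.
by rewrite -cubic_elt_comb => /eqP; rewrite cubic_elt_eq0 => /eqP/uv_free.
Qed.

Definition dual_elt (v : 'cV[F]_3) : L := dot (map_mx iota v) tau_dual.

Lemma dot_trace v u : iota (dot v u) = trace3 iota (dual_elt v * cubic_elt u).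
Proof.
rewrite -dot_map [map_mx iota u]cubic_elt_dual /dual_elt; move: tau_dual => w.
rewrite !dotDr !dotZr /trace3 !frobM.
have map_sg : map_mx iota v = map_mx sg (map_mx iota v).
  by apply/matrixP => i j; rewrite !mxE frob_iota.
have d1 : dot (map_mx iota v) (map_mx sg w) = sg (dot (map_mx iota v) w).
  by rewrite [in LHS]map_sg dot_map.
have d2 : dot (map_mx iota v) (map_mx sg (map_mx sg w)) =
    sg (sg (dot (map_mx iota v) w)).
  by rewrite [in LHS]map_sg dot_map d1.
by rewrite d1 d2; ring.
Qed.

Lemma dot_nondegenerate (v : 'cV[F]_3) : (forall u, dot v u = 0) -> v = 0.
Proof. by move=> v0; apply/colP => i; rewrite mxE -dot_delta. Qed.

Lemma dual_elt_eq0 v : (dual_elt v == 0) = (v == 0).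
Proof.
apply/eqP/eqP => [d0|->]; last by rewrite /dual_elt raddf0 dotC
  -[0](scale0r (0 : 'cV_3)) dotZr mul0r.
apply: dot_nondegenerate => u; apply: (fmorph_inj iota).
by rewrite dot_trace d0 mul0r rmorph0 /trace3 !rmorph0 !addr0.
Qed.

Lemma dual_elt_surj x : exists v, x = dual_elt v.
Proof.
have d_inj : injective dual_elt.
  move=> u v /eqP; rewrite -subr_eq0 => uv0; apply/eqP;
    rewrite -subr_eq0 -dual_elt_eq0.
  rewrite -(eqP uv0) /dual_elt !(dotC _ tau_dual) map_mxB -scaleN1r dotDr dotZr
    mulN1r.
  by [].
have [|g _ gK] := inj_card_bij d_inj; first by rewrite card_cubic_coords.
by exists (g x); rewrite gK.
Qed.

(** A 2-dimensional F-subspace of L occurs in two ways: as the set of lines of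
    the subplane through a point v, and as the kernel of a trace functional. *)
Lemma point_F_line v : v != 0 -> exists e f, indep iota e f /\
  forall u, dot v u = 0 <-> exists a b, cubic_elt u = iota a * e + iota b * f.
Proof.
move=> v0; have [u1 [u2 [u_free uE]]] := line_with_coords_basis v0.
exists (cubic_elt u1), (cubic_elt u2); split; first exact/indep_cubic_elt.
move=> u; rewrite uE; split=> [[[a b] /= ->]|[a [b]]].
  by exists a, b; rewrite cubic_elt_comb.
by rewrite -cubic_elt_comb => /cubic_elt_inj ->; exists (a, b).
Qed.

Lemma F_line_point e f : indep iota e f -> exists2 v, v != 0 &
  forall u, dot v u = 0 <-> exists a b, cubic_elt u = iota a * e + iota b * f.
Proof.
have [[u1 ->] [u2 ->]] := (cubic_elt_surj e, cubic_elt_surj f).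
move/indep_cubic_elt/line_with_coords_of_basis => [v v0 vE]; exists v => // u.
rewrite vE; split=> [[[a b] /= ->]|[a [b]]].
  by exists a, b; rewrite cubic_elt_comb.
by rewrite -cubic_elt_comb => /cubic_elt_inj ->; exists (a, b).
Qed.

Lemma trace_F_line g : g != 0 -> exists e f, indep iota e f /\
  forall x, trace3 iota (g * x) = 0 <-> exists a b, x = iota a * e + iota b * f.
Proof.
have [v ->] := dual_elt_surj g; rewrite dual_elt_eq0 =>
  /point_F_line[e [f [ef vE]]].
exists e, f; split=> // x; have [u ->] := cubic_elt_surj x.
by rewrite -vE -dot_trace -(rmorph0 iota); split=> [/fmorph_inj|->].
Qed.

Lemma F_line_trace e f : indep iota e f -> exists2 g, g != 0 &
  forall x, trace3 iota (g * x) = 0 <-> exists a b, x = iota a * e + iota b * f.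
Proof.
case/F_line_point => v v0 vE; exists (dual_elt v);
  first by rewrite dual_elt_eq0.
move=> x; have [u ->] := cubic_elt_surj x.
by rewrite -vE -dot_trace -(rmorph0 iota); split=> [/fmorph_inj|->].
Qed.

Lemma trace_nondegenerate g : (forall x, trace3 iota (g * x) = 0) -> g = 0.
Proof.
have [v ->] := dual_elt_surj g => g0; apply/eqP; rewrite dual_elt_eq0;
  apply/eqP.
by apply: dot_nondegenerate => u; apply: (fmorph_inj iota);
  rewrite dot_trace g0 rmorph0.
Qed.

End CubicCoordinates.

(** * Dual conics through the line at infinity *)

Lemma qform_map (R R' : comNzRingType) (f : {rmorphism R -> R'}) (Q : 'M[R]_3) x
  :
  qform (map_mx f Q) (map_mx f x) = f (qform Q x).
Proof. by rewrite /qform map_trmx -!map_mxM mxE. Qed.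

Lemma qform_mulmx (R : comNzRingType) (N Q : 'M[R]_3) u :
  qform (N *m Q *m N^T) u = qform Q (N^T *m u).
Proof. by rewrite /qform trmx_mul trmxK !mulmxA. Qed.

Lemma polar_map (R R' : comNzRingType) (f : {rmorphism R -> R'}) (Q : 'M[R]_3) x
  y :
  polar (map_mx f Q) (map_mx f x) (map_mx f y) = f (polar Q x y).
Proof. by rewrite /polar !map_trmx -map_mxD -!map_mxM mxE. Qed.

Lemma nondegenerate_qform_neq0 (K : fieldType) (Q : 'M[K]_3) :
  nondegenerate Q -> exists u, qform Q u != 0.
Proof.
move=> Q_nondeg; pose w : 'cV[K]_3 := col3 1 0 0.
have [Gw|/cV0Pn[i Gwi]] := eqVneq ((Q + Q^T) *m w) 0.
  by exists w; apply: Q_nondeg Gw; rewrite col3_eq0 oner_eq0.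
have polar_i : polar Q (delta_mx i 0) w = ((Q + Q^T) *m w) i 0.
  by rewrite /polar trmx_delta -mulmxA -rowE mxE.
have [Qw|] := eqVneq (qform Q w) 0; last by exists w.
have [Qi|] := eqVneq (qform Q (delta_mx i 0)) 0; last by exists (delta_mx i 0).
by exists (delta_mx i 0 + w); rewrite qformD Qw Qi !add0r polar_i.
Qed.

Section SpecialDualConics.
Variables (F L : finFieldType) (iota : {rmorphism F -> L}).
Hypothesis cardL : #|L| = (#|F| ^ 3)%N.
Variables (tau : L) (tau_prim : (#|L|.-1).-primitive_root tau).
Local Notation sg := (frob iota).
Local Notation cubic_elt := (cubic_elt iota tau).
Local Notation tau_dual := (tau_dual iota tau).
Local Notation tau_pt := (tau_pt tau).

Lemma map_frob_iota m n (A : 'M[F]_(m, n)) : map_mx sg (map_mx iota A) = map_mx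
  iota A.
Proof. by apply/matrixP => i j; rewrite !mxE frob_iota. Qed.

(** In the coordinates s, s', s'' of the lines, where s = cubic_elt u and the
    primes are conjugates, a quadratic form over F is a trace of
    al s^2 + be s s', and al is its value at the dual basis vector tau_dual. *)
Lemma special_qform_trace (Q : 'M[F]_3) : qform (map_mx iota Q) tau_dual = 0 ->
  exists be, forall u,
    iota (qform Q u) = trace3 iota (be * (cubic_elt u * sg (cubic_elt u))).
Proof.
move: (tau_dual) (cubic_elt_dual iota cardL tau_prim) => w uE.
set QL := map_mx iota Q => Q0.
have sgQ : map_mx sg QL = QL by apply: map_frob_iota.
have Q1 : qform QL (map_mx sg w) = 0 by rewrite -sgQ qform_map Q0 rmorph0.
have Q2 : qform QL (map_mx sg (map_mx sg w)) = 0 by rewrite -sgQ qform_map Q1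
  rmorph0.
exists (polar QL w (map_mx sg w)) => u.
rewrite -qform_map -/QL uE !qformD !qformZ Q0 Q1 Q2.
rewrite !polarDl !polarZl !polarZr /trace3 !frobM (frob3 iota cardL).
have p1 : sg (polar QL w (map_mx sg w)) =
    polar QL (map_mx sg w) (map_mx sg (map_mx sg w)).
  by rewrite -polar_map sgQ.
have p2 : sg (polar QL (map_mx sg w) (map_mx sg (map_mx sg w))) =
    polar QL w (map_mx sg (map_mx sg w)).
  rewrite -polar_map sgQ polarC; congr polar.
  by apply/matrixP => i j; rewrite !mxE; apply: frob3.
by rewrite p1 p2; ring.
Qed.

Definition ftrace (x : L) : F := odflt 0 [pick a | iota a == trace3 iota x].

Lemma iota_ftrace x : iota (ftrace x) = trace3 iota x.
Proof.
rewrite /ftrace; case: pickP => [a /eqP->|] //=.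
by have [a ->] := trace3_iota iota cardL x => /(_ a); rewrite eqxx.
Qed.

(** The form Tr (be s s'), written in the coordinates of the lines over F. *)
Definition special_qform (be : L) : 'M[F]_3 :=
  \matrix_(i, j) ftrace (be * (tau ^+ i * sg (tau ^+ j))).

(** For v over L the three products with the conjugates of (1, tau, tau^2) are
    no longer conjugate to each other. *)
Lemma special_qformE be (v : 'cV[L]_3) : qform (map_mx iota (special_qform be))
  v =
  be * (dot v tau_pt * dot v (map_mx sg tau_pt))
  + sg be * (dot v (map_mx sg tau_pt) * dot v (map_mx sg (map_mx sg tau_pt)))
  + sg (sg be) * (dot v (map_mx sg (map_mx sg tau_pt)) * dot v tau_pt).
Proof.
have dotE x : dot v (col3 1 x (x ^+ 2)) = \sum_i v i 0 * x ^+ i.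
  by rewrite /dot !big_ord_recl !big_ord0 !mxE /=.
have map_col3 x : map_mx sg (col3 1 x (x ^+ 2)) = col3 1 (sg x) (sg x ^+ 2).
  by apply/colP => -[[|[|[|i]]] lti] //;
    rewrite !mxE /= ?rmorph1 // (rmorphXn sg).
rewrite /tau_pt !map_col3 !dotE qformE /special_qform.
rewrite !big_ord_recl !big_ord0 !mxE !iota_ftrace /trace3 /=.
have s1 : sg 1 = 1 by apply: rmorph1.
rewrite !(expr0, expr1, expr2) !(frobM, s1) !(frob3 iota cardL).
ring.
Qed.

Lemma special_qform_cubic be u :
  iota (qform (special_qform be) u) = trace3 iota
    (be * (cubic_elt u * sg (cubic_elt u))).
Proof.
rewrite -qform_map special_qformE.
have -> : dot (map_mx iota u) (map_mx sg tau_pt) = sg (cubic_elt u).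
  by rewrite -[map_mx iota u]map_frob_iota dot_map dot_tau_pt.
have -> : dot (map_mx iota u) (map_mx sg (map_mx sg tau_pt)) = sg
  (sg (cubic_elt u)).
  by rewrite -[map_mx iota u]map_frob_iota -[map_mx iota u]map_frob_iota
    !dot_map dot_tau_pt.
by rewrite dot_tau_pt /trace3 !frobM (frob3 iota cardL).
Qed.

(** At a singular point on the curve, y = be s s' satisfies y'' = - y, hence
    2 y = 0 and y' = y, and then its trace 3 y = y is zero. *)
Lemma special_qform_nondegenerate be : be != 0 -> nondegenerate
  (special_qform be).
Proof.
move=> be0 w w0 Gw; apply/negP => /eqP Qw.
set s := cubic_elt w; have s0 : s != 0 by rewrite (cubic_elt_eq0 iota cardL
  tau_prim).
have polar0 u : polar (special_qform be) u w = 0.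
  by rewrite /polar -mulmxA Gw mulmx0 mxE.
have grad0 : be * sg s + sg (sg (be * s)) = 0.
  apply: (trace_nondegenerate (iota := iota) cardL tau_prim) => x.
  have [u ->] := cubic_elt_surj iota cardL tau_prim x.
  rewrite -[RHS](rmorph0 iota) -(polar0 u).
  have -> : polar (special_qform be) u w = qform (special_qform be)
    (1 *: u + 1 *: w)
      - qform (special_qform be) u - qform (special_qform be) w.
    by rewrite !scale1r qformD; ring.
  rewrite !(rmorphB iota) !special_qform_cubic cubic_elt_comb rmorph1 !mul1r
    -/s.
  rewrite /trace3 !(frobD, frobM, frob3 iota cardL); ring.
set y := be * (s * sg s).
have y_trace : trace3 iota y = 0 by rewrite /y /s -special_qform_cubic Qw
  rmorph0.
have y2 : sg (sg y) = - y.
  apply/eqP; rewrite -subr_eq0 opprK; apply/eqP.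
  rewrite -[RHS](mulr0 s) -grad0 /y !frobM (frob3 iota cardL); ring.
have y1 : sg y = y.
  have sN x : sg (- x) = - sg x by apply: rmorphN.
  by rewrite -[LHS](frob3 iota cardL) y2 !sN y2 opprK.
have y0 : y = 0 by rewrite -y_trace /trace3 y2 y1; ring.
have : y != 0 by rewrite !mulf_neq0 ?fmorph_eq0.
by rewrite y0 eqxx.
Qed.

(** The zeros of Tr (be s s') are the inverses of the elements of an F-line,
    because s s' is an F-multiple of the conjugate of 1 / s by s''. *)
Lemma trace_inverse be s : s != 0 ->
  (trace3 iota (be * (s * sg s)) == 0) = (trace3 iota (sg be * s^-1) == 0).
Proof.
move=> s0; have ss0 : sg (sg s) != 0 by rewrite !fmorph_eq0.
have [c cE] := norm3_iota iota cardL s.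
have c0 : iota c != 0 by rewrite -cE norm3_eq0.
have -> : be * (s * sg s) = iota c * (be * sg (sg s^-1)).
  by rewrite -cE /norm3 !frobV; field.
rewrite trace3Z mulf_eq0 (negPf c0) orFb -(trace3_frob iota cardL).
by rewrite frobM (frob3 iota cardL).
Qed.

End SpecialDualConics.

(** * The lines of a subplane *)

Section Homographies.
Variables (K : finFieldType) (n : nat).
Implicit Types (A B : 'M[K]_n) (U : subspace K n) (x y : 'cV[K]_n).

Lemma memv_homography A U y : y \in homography A U <-> exists2 x, x \in U &
  y = A *m x.
Proof.
split=> [/memv_imgP[x Ux]|[x Ux ->]]; first by rewrite lfunE; exists x.
by apply/memv_imgP; exists x; rewrite ?lfunE.
Qed.

Lemma homography_vline A x : homography A <[x]>%VS = <[A *m x]>%VS.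
Proof. by rewrite /homography limg_line lfunE. Qed.

Lemma homography_mul A B U : homography (A *m B) U = homography A
  (homography B U).
Proof.
apply/vspaceP => y; apply/idP/idP => /memv_homography[x].
  move=> Ux ->; apply/memv_homography; exists (B *m x); last by rewrite mulmxA.
  by apply/memv_homography; exists x.
case/memv_homography => x' Ux' -> ->; apply/memv_homography.
by exists x'; rewrite ?mulmxA.
Qed.

Lemma unitmx_mul_inj A x y : A \in unitmx -> A *m x = A *m y -> x = y.
Proof. by move=> uA /(congr1 (mulmx (invmx A))); rewrite !mulKmx. Qed.

Lemma unitmx_mul_neq0 A x : A \in unitmx -> x != 0 -> A *m x != 0.
Proof.
by move=> uA; apply: contraNneq => Ax0; apply/eqP/(unitmx_mul_inj uA);
  rewrite mulmx0.
Qed.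

Lemma mem_homography_mul A U x : A \in unitmx ->
  (A *m x \in homography A U) = (x \in U).
Proof.
move=> uA; apply/idP/idP => [|Ux]; last by apply/memv_homography; exists x.
by case/memv_homography => x' Ux' /(unitmx_mul_inj uA) ->.
Qed.

Lemma dim_homography A U : A \in unitmx -> \dim (homography A U) = \dim U.
Proof.
move=> uA; apply: limg_dim_eq; apply/vspaceP => x;
  rewrite memv_cap memv_ker lfunE /= memv0.
apply/andP/eqP => [[_ /eqP Ax0]|->]; last by rewrite mulmx0 mem0v.
by apply: (unitmx_mul_inj uA); rewrite Ax0 mulmx0.
Qed.

Lemma homography_inj A : A \in unitmx -> injective (homography A).
Proof.
by move=> uA U V UV; apply/vspaceP => x; rewrite -(mem_homography_mul U x uA) UV
  mem_homography_mul.
Qed.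

Lemma homography_scale a A U : a != 0 -> homography (a *: A) U = homography A U.
Proof.
move=> a0; apply/vspaceP => y; apply/idP/idP => /memv_homography[x Ux ->];
  apply/memv_homography.
  by exists (a *: x); rewrite ?memvZ // -scalemxAl scalemxAr.
by exists (a^-1 *: x); rewrite ?memvZ // -scalemxAl -scalemxAr scalerA divff
  ?scale1r.
Qed.

End Homographies.

Lemma neq_vlines_free2 (K : finFieldType) (n : nat) (x y : 'cV[K]_n) :
  x != 0 -> y != 0 -> <[x]>%VS != <[y]>%VS :> subspace K n -> free2 x y.
Proof.
move=> x0 y0 xy a b ab0; have [b0|b0] := eqVneq b 0.
  split=> //; apply/eqP; move/eqP: ab0.
  by rewrite b0 scale0r addr0 scaler_eq0 (negPf x0) orbF.
case/eqP: xy; have [a0|a0] := eqVneq a 0.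
  by move/eqP: ab0; rewrite a0 scale0r add0r scaler_eq0 (negPf b0) (negPf y0).
have -> : y = (- (a / b)) *: x.
  apply: (scalerI b0); rewrite scalerA mulrN mulrCA divff // mulr1 scaleNr;
    apply/eqP.
  by rewrite -subr_eq0 opprK addrC ab0.
by rewrite vline_scale // oppr_eq0 mulf_neq0 ?invr_eq0.
Qed.

Lemma free2_neq_vlines (K : finFieldType) (n : nat) (x y : 'cV[K]_n) :
  free2 x y -> <[x]>%VS != <[y]>%VS :> subspace K n.
Proof.
move=> xy; apply/eqP => e; have /vlineP[a xE] : x \in <[y]>%VS by rewrite -e
  memv_line.
have [] := xy 1 (- a); last by move/eqP; rewrite oner_eq0.
by rewrite xE scale1r scaleNr subrr.
Qed.

Lemma free2_map (F L : finFieldType) (iota : {rmorphism F -> L}) (n : nat)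
    (u v : 'cV[F]_n) :
  free2 u v -> free2 (map_mx iota u) (map_mx iota v).
Proof.
have map_neq0 (x : 'cV[F]_n) : x != 0 -> map_mx iota x != 0.
  by rewrite map_mx_eq0.
move=> uv; have u0 : u != 0 by have := free2_neq0 uv (a := 1) (b := 0);
  rewrite scale1r scale0r addr0 xpair_eqE oner_eq0; apply.
have v0 : v != 0 by have := free2_neq0 uv (a := 0) (b := 1);
  rewrite scale1r scale0r add0r xpair_eqE oner_eq0 andbF; apply.
apply: neq_vlines_free2; rewrite ?map_neq0 //; apply/eqP => e.
have /vlineP[c uE] : map_mx iota u \in <[map_mx iota v]>%VS by rewrite -e
  memv_line.
have /cV0Pn[i vi0] := v0; have ivi0 : iota (v i 0) != 0 by rewrite fmorph_eq0.
have cE : c = iota (u i 0 / v i 0).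
  move/matrixP/(_ i 0): uE; rewrite !mxE => uE.
  by rewrite rmorphM fmorphV uE mulfK.
have [] := uv 1 (- (u i 0 / v i 0)); last by move/eqP; rewrite oner_eq0.
apply: (@map_mx_inj _ _ iota); rewrite scale1r scaleNr map_mxB map_mxZ -cE uE.
by rewrite subrr raddf0.
Qed.

Section SubplaneLines.
Variables (F L : finFieldType) (iota : {rmorphism F -> L}).
Variables (A : 'M[L]_3) (A_unit : A \in unitmx).
Local Notation pi := (subplane_of iota A).

Lemma subplaneP P :
  P \in pi <-> exists2 v : 'cV[F]_3, v != 0 & P = <[A *m map_mx iota v]>%VS.
Proof.
split=> [/imsetP[_ /imsetP[v v0 ->] ->]|[v v0 ->]].
  by exists v; rewrite ?homography_vline //; rewrite inE in v0.
rewrite -homography_vline; apply: imset_f; apply: imset_f.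
by rewrite inE.
Qed.

Definition subplane_line (u : 'cV[F]_3) : subspace L 3 :=
  homography A (line_with_coords (map_mx iota u)).

Lemma mem_subplane_line u v :
  (<[A *m map_mx iota v]> <= subplane_line u)%VS = (dot u v == 0).
Proof.
by rewrite -memvE mem_homography_mul // mem_line_with_coords dot_map fmorph_eq0.
Qed.

Lemma dim_subplane_line u : u != 0 -> \dim (subplane_line u) = 2.
Proof. by move=> u0; rewrite dim_homography // dim_line_with_coords //
  map_mx_eq0. Qed.

Lemma lines_of_subplane : lines_of pi = [set subplane_line u | u : 'cV[F]_3 &
  u != 0].
Proof.
have joinE u v1 v2 : u != 0 -> free2 (A *m map_mx iota v1)
  (A *m map_mx iota v2) ->
    dot u v1 = 0 -> dot u v2 = 0 ->
    subplane_line u = (<[A *m map_mx iota v1]> + <[A *m map_mx iota v2]>)%VS.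
  move=> u0 v_free uv1 uv2; apply: dim2_vline2; rewrite ?dim_subplane_line //.
    by rewrite memvE mem_subplane_line uv1.
  by rewrite memvE mem_subplane_line uv2.
apply/setP => l; apply/imsetP/imsetP => [[[P Q]]|[u]].
  rewrite inE /= in_setX => /andP[/andP[]].
  case/subplaneP => v1 v10 -> /subplaneP[v2 v20 ->] PQ ->.
  have v_free := neq_vlines_free2 (unitmx_mul_neq0 A_unit _)
    (unitmx_mul_neq0 A_unit _) PQ.
  have [u u0 [uv1 uv2]] := orthogonal_to_two v1 v2.
  exists u; rewrite ?inE //; apply/esym/joinE => //.
  by apply: v_free; rewrite map_mx_eq0.
rewrite inE => u0 ->; have [v1 [v2 [v_free uE]]] := line_with_coords_basis u0.
have Av_free : free2 (A *m map_mx iota v1) (A *m map_mx iota v2).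
  move=> a b; rewrite !scalemxAr -mulmxDr -(mulmx0 _ A) =>
    /(unitmx_mul_inj A_unit).
  exact: free2_map.
have uv1 : dot u v1 = 0 by apply/uE; exists (1, 0);
  rewrite scale1r scale0r addr0.
have uv2 : dot u v2 = 0 by apply/uE; exists (0, 1);
  rewrite scale1r scale0r add0r.
exists (<[A *m map_mx iota v1]>%VS, <[A *m map_mx iota v2]>%VS);
  last exact: joinE.
have v_neq0 := free2_neq0 v_free.
have v10 : v1 != 0 by have := v_neq0 1 0; rewrite scale1r scale0r addr0
  xpair_eqE oner_eq0; apply.
have v20 : v2 != 0 by have := v_neq0 0 1; rewrite scale1r scale0r add0r
  xpair_eqE oner_eq0 andbF; apply.
rewrite inE in_setX /= (free2_neq_vlines Av_free) andbT.
by apply/andP; split; apply/subplaneP; [exists v1 | exists v2].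
Qed.

End SubplaneLines.

(** * The splash and its sublines *)

Lemma mem_infinity (K : fieldType) (n : nat) (x : 'cV[K]_n.+1) :
  (x \in infinity K n) = (x ord_max 0 == 0).
Proof.
rewrite memv_ker lfunE /=; apply/eqP/eqP => [/matrixP/(_ 0 0)|x0];
  first by rewrite !mxE.
by apply/matrixP => i j; rewrite !ord1 !mxE.
Qed.

Section LineCoordinates.
Variable K : finFieldType.
Implicit Types (u v : 'cV[K]_3).

Lemma line_with_coords_inj u v : u != 0 -> line_with_coords u = line_with_coords
  v ->
  exists c, v = c *: u.
Proof.
case/cV0Pn => i ui0 uv; exists (v i 0 / u i 0); apply/colP => j; rewrite mxE.
have : u i 0 *: delta_mx j 0 + - u j 0 *: delta_mx i 0 \in line_with_coords v.
  rewrite -uv mem_line_with_coords dotDr !dotZr !dot_delta mulNr.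
  by rewrite mulrC subrr.
rewrite mem_line_with_coords dotDr !dotZr !dot_delta mulNr subr_eq0 => /eqP e.
by apply: (mulfI ui0); rewrite e; field.
Qed.

Lemma homography_line_with_coords (B : 'M[K]_3) u : B \in unitmx ->
  homography B (line_with_coords u) = line_with_coords ((invmx B)^T *m u).
Proof.
move=> uB; apply/vspaceP => y; rewrite mem_line_with_coords dot_mulmx.
by rewrite -{1}(mulKVmx uB y) mem_homography_mul // mem_line_with_coords.
Qed.

End LineCoordinates.

Section AtInfinity.
Variables (F L : finFieldType) (iota : {rmorphism F -> L}).
Hypothesis cardL : #|L| = (#|F| ^ 3)%N.
Variables (tau : L) (tau_prim : (#|L|.-1).-primitive_root tau).
Local Notation sg := (frob iota).
Local Notation cubic_elt := (cubic_elt iota tau).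
Local Notation tau_pt := (tau_pt tau).
Local Notation indep := (indep iota).
Local Notation F_line := (F_line iota).

(** In the frame of the subplane the line at infinity joins (1, tau, tau^2) to
    its conjugate. *)
Definition inf_coords : 'cV[L]_3 := col3 (tau * sg tau) (- tau - sg tau) 1.

(** The matrix defining the reference subplane maps this vector to the multiple
    by tau - tau^q of (s, s^q, 0). *)
Definition inf_vec (s : L) : 'cV[L]_3 := sg s *: tau_pt - s *: map_mx sg tau_pt.

Lemma map_tau_pt : map_mx sg tau_pt = col3 1 (sg tau) (sg tau ^+ 2).
Proof.
by apply/colP => -[[|[|[|i]]] lti] //;
  rewrite !mxE /= ?rmorph1 // (rmorphXn sg).
Qed.

Lemma inf_coords_neq0 : inf_coords != 0.
Proof. by rewrite col3_eq0 oner_eq0 !andbF. Qed.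

Lemma dot_inf_coords_tau : dot inf_coords tau_pt = 0.
Proof. by rewrite dot_col3; ring. Qed.

Lemma dot_inf_coords_conj : dot inf_coords (map_mx sg tau_pt) = 0.
Proof. by rewrite map_tau_pt dot_col3; ring. Qed.

Lemma dot_conj u : dot (map_mx iota u) (map_mx sg tau_pt) = sg (cubic_elt u).
Proof. by rewrite -[map_mx iota u](map_frob_iota iota) dot_map dot_tau_pt. Qed.

Lemma dot_subr (u x y : 'cV[L]_3) a b : dot u (a *: x - b *: y) = a * dot u x -
  b * dot u y.
Proof. by rewrite -scaleNr dotDr !dotZr mulNr. Qed.

Lemma dot_inf_vec u : dot (map_mx iota u) (inf_vec (cubic_elt u)) = 0.
Proof. by rewrite dot_subr dot_tau_pt dot_conj mulrC subrr. Qed.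

Lemma inf_coords_inf_vec s : dot inf_coords (inf_vec s) = 0.
Proof. by rewrite dot_subr dot_inf_coords_tau dot_inf_coords_conj !mulr0 subrr.
  Qed.

(** On the line at infinity x is a combination of (1, tau, tau^2) and its
    conjugate, and incidence with u fixes the ratio of the coefficients. *)
Lemma inf_vec_unique u x : u != 0 ->
  dot (map_mx iota u) x = 0 -> dot inf_coords x = 0 ->
  exists c, x = c *: inf_vec (cubic_elt u).
Proof.
move=> u0; have [d1 _ _] := tau_diffs iota cardL tau_prim.
have s0 : sg (cubic_elt u) != 0 by rewrite fmorph_eq0
  (cubic_elt_eq0 iota cardL tau_prim).
rewrite (col3E x); move: (x 0 0) (x 1 0) (x (1 + 1) 0) => x0 x1 x2 ux wx.
pose a := (x1 - sg tau * x0) / (tau - sg tau);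
  pose b := (tau * x0 - x1) / (tau - sg tau).
have xE : col3 x0 x1 x2 = a *: tau_pt - (- b) *: map_mx sg tau_pt.
  have x2E : x2 = (tau + sg tau) * x1 - tau * sg tau * x0.
    by move: wx; rewrite dot_col3 => /eqP; rewrite -subr_eq0 => /eqP wx;
      apply/subr0_eq; rewrite -wx; ring.
  rewrite map_tau_pt x2E; apply/colP => -[[|[|[|i]]] lti] //;
    rewrite !mxE /= /a /b; by field.
move: ux; rewrite xE dot_subr dot_tau_pt dot_conj => e.
exists (a / sg (cubic_elt u)); rewrite scalerBr !scalerA divfK //;
  congr (_ - _ *: _).
apply: (mulIf s0); rewrite mulrAC divfK //.
by apply/esym/subr0_eq.
Qed.

Section Frame.
Variables (A : 'M[L]_3) (A_unit : A \in unitmx).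
Hypothesis A_inf : forall x, (A *m x \in ell_inf L) = (dot inf_coords x == 0).
Local Notation pi := (subplane_of iota A).

Definition inf_pt s : subspace L 3 := <[A *m inf_vec s]>%VS.

Lemma ell_inf_line : ell_inf L = homography A (line_with_coords inf_coords).
Proof.
apply/vspaceP => y; rewrite -(mulKVmx A_unit y) A_inf mem_homography_mul //.
by rewrite mem_line_with_coords.
Qed.

Lemma subplane_line_meet_inf u : u != 0 ->
  (subplane_line iota A u :&: ell_inf L)%VS = inf_pt (cubic_elt u).
Proof.
move=> u0; apply/vspaceP => y; rewrite -(mulKVmx A_unit y);
  move: (invmx A *m y) => x.
rewrite memv_cap A_inf mem_homography_mul // mem_line_with_coords.
apply/andP/vlineP => [[/eqP ux /eqP wx]|[c]].
  have [c ->] := inf_vec_unique u0 ux wx.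
  by exists c; rewrite scalemxAr.
rewrite scalemxAr => /(unitmx_mul_inj A_unit) ->.
by rewrite !dotZr dot_inf_vec inf_coords_inf_vec mulr0 eqxx.
Qed.

Lemma splash_subplane : splash pi = [set inf_pt s | s : L & s != 0].
Proof.
rewrite /splash /meet_ell_inf lines_of_subplane //.
apply/setP => P; apply/imsetP/imsetP => [[l /imsetP[u]]|[s]]; rewrite inE.
  move=> u0 -> ->; exists (cubic_elt u); last by rewrite subplane_line_meet_inf.
  by rewrite inE (cubic_elt_eq0 iota cardL tau_prim).
have [u ->] := cubic_elt_surj iota cardL tau_prim s.
rewrite (cubic_elt_eq0 iota cardL tau_prim) => u0 ->.
exists (subplane_line iota A u); last by rewrite subplane_line_meet_inf.
by apply: imset_f; rewrite inE.
Qed.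

Lemma meet_ell_inf_lines (ls : {set subspace L 3}) (Z : {set L}) :
  (forall u, u != 0 -> (subplane_line iota A u \in ls) = (cubic_elt u \in Z)) ->
  (forall s, s \in Z -> s != 0) ->
  meet_ell_inf (ls :&: lines_of pi) = [set inf_pt s | s in Z].
Proof.
move=> lsZ Z0; rewrite /meet_ell_inf lines_of_subplane //.
apply/setP => P; apply/imsetP/imsetP => [[l]|[s]].
  rewrite inE => /andP[l_ls /imsetP[u]]; rewrite inE => u0 lE ->.
  exists (cubic_elt u); first by rewrite -lsZ // -lE.
  by rewrite lE subplane_line_meet_inf.
have [u ->] := cubic_elt_surj iota cardL tau_prim s => uZ ->.
have u0 : u != 0 by rewrite -(cubic_elt_eq0 iota cardL tau_prim) Z0.
exists (subplane_line iota A u); last by rewrite subplane_line_meet_inf.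
by rewrite inE lsZ // uZ; apply: imset_f; rewrite inE.
Qed.

(** The coordinates of the lines through a point of the subplane form a
    2-dimensional F-subspace. *)
Lemma pencil_sublineP b : pencil_subline pi b <->
  exists e f, indep e f /\ b = [set inf_pt s | s in F_line e f].
Proof.
have pencilE v e f : (forall u, dot v u = 0 <-> exists a b, cubic_elt u = iota a
  * e + iota b * f) ->
    meet_ell_inf [set l in lines_of pi | (<[A *m map_mx iota v]> <= l)%VS] =
    [set inf_pt s | s in F_line e f].
  move=> vE; rewrite -(@meet_ell_inf_lines
    [set l | (<[A *m map_mx iota v]> <= l)%VS] (F_line e f)).
  - by congr meet_ell_inf; apply/setP => l; rewrite !inE andbC.
  - move=> u u0; rewrite inE mem_subplane_line // dotC.
    apply/eqP/F_lineP => [/vE ab|[_ ab]]; last exact/vE.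
    by rewrite (cubic_elt_eq0 iota cardL tau_prim).
  by move=> s; apply: F_line_neq0.
split=> [[_ /subplaneP[v v0 ->] ->]|[e [f [ef ->]]]].
  have [e [f [ef vE]]] := point_F_line iota cardL tau_prim v0.
  by exists e, f; split=> //; apply: pencilE.
have [v v0 vE] := F_line_point cardL tau_prim ef.
exists <[A *m map_mx iota v]>%VS; first by apply/subplaneP; exists v.
exact/esym/pencilE.
Qed.

End Frame.
End AtInfinity.

(** * Frames and conjugate lines *)

Lemma delta_mx_eq0 (R : nzRingType) (m n : nat) (i : 'I_m) (j : 'I_n) :
  (delta_mx i j == 0 :> 'M[R]_(m, n)) = false.
Proof. by apply/eqP => /matrixP/(_ i j)/eqP; rewrite !mxE !eqxx oner_eq0. Qed.

Section Frames.
Variables (F L : finFieldType) (iota : {rmorphism F -> L}).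

(** A matrix mapping the points of PG(2, q) to points of PG(2, q) maps the
    unit vectors to multiples of vectors over F, and as the same holds for
    their sum the factors agree up to elements of F. *)
Lemma subplane_frame_unique (A B : 'M[L]_3) : A \in unitmx -> B \in unitmx ->
  subplane_of iota A = subplane_of iota B ->
  exists a N, [/\ a != 0, N \in unitmx & B = a *: (A *m map_mx iota N)].
Proof.
move=> uA uB AB.
have ptE (v : 'cV[F]_3) : v != 0 -> exists cw : L * 'cV[F]_3,
    B *m map_mx iota v = cw.1 *: (A *m map_mx iota cw.2).
  move=> v0; have : <[B *m map_mx iota v]>%VS \in subplane_of iota A.
    by rewrite AB; apply/subplaneP; exists v.
  case/subplaneP => w _ e; have /vlineP[c vE] : B *m map_mx iota v \in
    <[A *m map_mx iota w]>%VS.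
    by rewrite -e memv_line.
  by exists (c, w).
have /fin_all_exists[g gE] (j : 'I_3) : exists cw : L * 'cV[F]_3,
    B *m map_mx iota (delta_mx j 0) = cw.1 *: (A *m map_mx iota cw.2).
  by apply: ptE; rewrite delta_mx_eq0.
pose M : 'M[F]_3 := \matrix_(i, j) (g j).2 i 0.
pose d : 'rV[L]_3 := \row_j (g j).1.
have BE : B = A *m map_mx iota M *m diag_mx d.
  apply/matrixP => i j; rewrite mul_mx_diag mxE.
  have := congr1 (fun x : 'cV[L]_3 => x i 0) (gE j).
  rewrite map_delta_mx -colE !mxE => ->; rewrite mulrC; congr (_ * _).
  by apply: eq_bigr => k _; rewrite !mxE.
have : B \in unitmx by [].
rewrite {1}BE !unitmx_mul uA /= map_unitmx => /andP[uM ud].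
have [[a w] /= aE] : exists cw : L * 'cV[F]_3,
    B *m map_mx iota (const_mx 1) = cw.1 *: (A *m map_mx iota cw.2).
  by apply: ptE; apply/cV0Pn; exists 0; rewrite mxE oner_eq0.
have dE : d^T = a *: map_mx iota (invmx M *m w).
  have uAM : A *m map_mx iota M \in unitmx by rewrite unitmx_mul uA map_unitmx.
  apply: (unitmx_mul_inj uAM); rewrite -scalemxAr -[in RHS]mulmxA
    -[in RHS]map_mxM mulKVmx // -aE BE.
  rewrite -[in RHS]mulmxA; congr (_ *m _); apply/colP => i.
  by rewrite mul_diag_mx !mxE rmorph1 mulr1.
have B_scal : B = a *: (A *m map_mx iota (M *m diag_mx (invmx M *m w)^T)).
  rewrite BE map_mxM map_diag_mx mulmxA scalemxAr; congr (_ *m _).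
  by rewrite -[d]trmxK dE; apply/matrixP => i j; rewrite !mxE mulrnAr.
have a0 : a != 0.
  apply: contraTneq uB => a0; rewrite B_scal a0 scale0r.
  by apply/negP => /unitrP[C [_ /eqP]]; rewrite mul0r eq_sym oner_eq0.
exists a, (M *m diag_mx (invmx M *m w)^T); split=> //.
by move: uB; rewrite {1}B_scal unitmxZ ?unitfE // unitmx_mul uA map_unitmx.
Qed.

Variables (sigma : {rmorphism L -> L}) (M A : 'M[L]_3).
Hypotheses (uM : M \in unitmx) (uA : A \in unitmx).

Lemma mem_collineation U y :
  y \in collineation sigma M U <-> exists2 v, v \in U & y = M *m map_mx sigma v.
Proof.
have [sigma' _ sigmaK] := inj_card_bij (fmorph_inj sigma) (leqnn _).
apply: mem_span_image; first by exists 0; rewrite ?mem0v // raddf0 mulmx0.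
move=> a x x' Ux Ux'; exists (sigma' a *: x + x');
  first by rewrite rpredD ?rpredZ.
by rewrite map_mxD map_mxZ sigmaK mulmxDr scalemxAr.
Qed.

(** A collineation fixing the unit points and the points (1, a) of the lines
    joining them has a scalar matrix and fixes a. *)
Lemma subplane_pointwise_fixed :
  (forall P, P \in subplane_of iota A -> collineation sigma M P = P) ->
  exists c, [/\ c != 0, M *m map_mx sigma A = c *: A & forall a, sigma (iota a)
    = iota a].
Proof.
move=> fixP; pose B := invmx A *m (M *m map_mx sigma A).
have uB : B \in unitmx by rewrite !unitmx_mul unitmx_inv uA uM map_unitmx.
have BE (v : 'cV[F]_3) : v != 0 ->
    exists c, B *m map_mx sigma (map_mx iota v) = c *: map_mx iota v.
  move=> v0; have : M *m map_mx sigma (A *m map_mx iota v) \in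
    <[A *m map_mx iota v]>%VS.
    rewrite -(fixP <[A *m map_mx iota v]>%VS); last by apply/subplaneP;
      exists v.
    by apply/mem_collineation; exists (A *m map_mx iota v); rewrite ?memv_line.
  case/vlineP => c e; exists c; apply: (unitmx_mul_inj uA).
  by rewrite mulmxA mulKVmx // -scalemxAr -e map_mxM !mulmxA.
have Bd j : exists c, B *m delta_mx j (0 : 'I_1) = c *: delta_mx j 0.
  have [|c e] := BE (delta_mx j 0); first by rewrite delta_mx_eq0.
  by exists c; rewrite !map_delta_mx in e.
have [c0 c0E] := Bd 0.
have Bcomb (j : 'I_3) a : j != 0 -> B *m delta_mx j (0 : 'I_1) = c0 *: delta_mx
  j 0 /\ sigma (iota a) = iota a.
  move=> j0; have [cj cjE] := Bd j.
  have c0_neq0 : c0 != 0.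
    have : B *m delta_mx 0 (0 : 'I_1) != 0 by rewrite unitmx_mul_neq0 //
      delta_mx_eq0.
    by rewrite c0E scaler_eq0 delta_mx_eq0 orbF.
  have scal b : cj * sigma (iota b) = c0 * iota b.
    have [|c] := BE (delta_mx 0 0 + b *: delta_mx j 0).
      apply/cV0Pn; exists 0; rewrite !mxE !eqxx [0 == j]eq_sym (negPf j0) mulr0
        addr0; exact: oner_neq0.
    rewrite !map_mxD !map_mxZ !map_delta_mx mulmxDr -scalemxAr c0E cjE =>
      /colP e.
    have := (e 0, e j); rewrite !mxE !eqxx (negPf j0) [0 == j]eq_sym (negPf j0).
    rewrite !andbT !mulr0 !mulr1 !addr0 !add0r => -[e1 e2].
    by rewrite mulrC e2 e1 mulr1.
  have cjc0 : cj = c0 by have := scal 1; rewrite !rmorph1 !mulr1.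
  split; first by rewrite cjE cjc0.
  by have := scal a; rewrite cjc0 => /(mulfI c0_neq0).
exists c0; split.
- have : B *m delta_mx 0 (0 : 'I_1) != 0 by rewrite unitmx_mul_neq0 //
    delta_mx_eq0.
  by rewrite c0E scaler_eq0 delta_mx_eq0 orbF.
- have -> : M *m map_mx sigma A = A *m B by rewrite mulKVmx.
  have -> : B = c0%:M; last by rewrite mul_mx_scalar.
  apply/matrixP => i j.
  have Bj : B *m delta_mx j (0 : 'I_1) = c0 *: delta_mx j 0.
    by have [->//|j0] := eqVneq j 0; have [] := Bcomb j 0 j0.
  have := congr1 (fun x : 'cV[L]_3 => x i 0) Bj;
    rewrite -colE !mxE eqxx andbT => ->.
  by rewrite mulr_natr.
by move=> a; have [] := Bcomb 1 a isT.
Qed.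

End Frames.

Section DualConicSublines.
Variables (F L : finFieldType) (iota : {rmorphism F -> L}).
Hypothesis cardL : #|L| = (#|F| ^ 3)%N.
Variables (tau : L) (tau_prim : (#|L|.-1).-primitive_root tau).
Local Notation sg := (frob iota).
Local Notation cubic_elt := (cubic_elt iota tau).
Local Notation inf_coords := (inf_coords iota tau).
Local Notation indep := (indep iota).
Local Notation F_line := (F_line iota).
Variables (A : 'M[L]_3) (A_unit : A \in unitmx).
Hypothesis A_inf : forall x, (A *m x \in ell_inf L) = (dot inf_coords x == 0).
Local Notation pi := (subplane_of iota A).
Local Notation inf_pt := (inf_pt iota tau A).

Lemma mem_extended_dual_conic (Q : 'M[F]_3) w : w != 0 ->
  (homography A (line_with_coords w) \in extended_dual_conic iota A Q) =
  (qform (map_mx iota Q) w == 0).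
Proof.
move=> w0; apply/imsetP/idP => [[v]|Qw]; last by exists w; rewrite ?inE ?w0.
rewrite inE => /andP[v0 /eqP Qv] /(homography_inj A_unit).
case/(line_with_coords_inj w0) => c vE; move: v0 Qv.
rewrite vE scaler_eq0 negb_or qformZ => /andP[c0 _] /eqP.
by rewrite mulf_eq0 sqrf_eq0 (negPf c0).
Qed.

Lemma extended_dual_conic_change (B : 'M[L]_3) (Q : 'M[F]_3) a N :
  a != 0 -> N \in unitmx -> B = a *: (A *m map_mx iota N) ->
  extended_dual_conic iota B Q = extended_dual_conic iota A (N *m Q *m N^T).
Proof.
move=> a0 uN ->; have uN' : map_mx iota N \in unitmx by rewrite map_unitmx.
have uNT : (map_mx iota N)^T \in unitmx by rewrite unitmx_tr.
have lineE y : homography (a *: (A *m map_mx iota N))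
  (line_with_coords ((map_mx iota N)^T *m y))
    = homography A (line_with_coords y).
  rewrite homography_scale // homography_mul homography_line_with_coords //.
  by rewrite mulmxA -trmx_mul mulmxV // trmx1 mul1mx.
have QE y : qform (map_mx iota (N *m Q *m N^T)) y = qform (map_mx iota Q)
  ((map_mx iota N)^T *m y).
  by rewrite !map_mxM -map_trmx qform_mulmx.
apply/setP => l; apply/imsetP/imsetP => -[w]; rewrite inE => /andP[w0 Qw] ->.
  exists (invmx (map_mx iota N)^T *m w).
    by rewrite inE QE mulKVmx // Qw unitmx_mul_neq0 ?unitmx_inv.
  by rewrite -lineE mulKVmx.
exists ((map_mx iota N)^T *m w); last by rewrite lineE.
by rewrite inE -QE Qw unitmx_mul_neq0.
Qed.

(** A line s lies on the dual conic Tr (be s s') = 0 exactly when 1 / s is in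
    an F-line, by [trace_inverse]. *)
Lemma trace_conic_subline (Q : 'M[F]_3) be :
  (forall u, iota (qform Q u) = trace3 iota
    (be * (cubic_elt u * sg (cubic_elt u)))) ->
  forall e f, (forall x, trace3 iota (sg be * x) = 0 <->
    exists a b, x = iota a * e + iota b * f) ->
  meet_ell_inf (extended_dual_conic iota A Q :&: lines_of pi) =
  [set inf_pt s^-1 | s in F_line e f].
Proof.
move=> Q_trace e f efE.
have -> : [set inf_pt s^-1 | s in F_line e f] =
  [set inf_pt s | s in [set x^-1 | x in F_line e f]].
  by rewrite -imset_comp.
apply: (meet_ell_inf_lines cardL tau_prim A_unit A_inf) => [u u0|s]; last first.
  by case/imsetP => x /F_line_neq0 x0 ->; rewrite invr_eq0.
have s0 : cubic_elt u != 0 by rewrite (cubic_elt_eq0 iota cardL tau_prim).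
rewrite mem_extended_dual_conic ?map_mx_eq0 // qform_map Q_trace trace_inverse
  //.
apply/eqP/imsetP => [/efE ab|[x /F_lineP[x0 ab] ->]]; last by rewrite invrK;
  apply/efE.
exists (cubic_elt u)^-1; last by rewrite invrK.
by apply/F_lineP; rewrite invr_eq0.
Qed.

(** Every frame of the subplane giving the dual conic can be replaced by the
    one used here. As the line at infinity lies on the dual conic, the form
    vanishes at inf_coords and hence at its conjugate tau_dual. *)
Lemma dual_conic_subline_F_line b : dual_conic_subline iota pi b ->
  exists e f, indep e f /\ b = [set inf_pt s^-1 | s in F_line e f].
Proof.
case=> D [B [Q [[uB piE] Q_nondeg DE D_inf _]]] ->.
have [a [N [a0 uN BE]]] := subplane_frame_unique A_unit uB piE.
rewrite (extended_dual_conic_change Q a0 uN BE) in DE.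
set Q' := N *m Q *m N^T in DE.
have [u Q'u] : exists u, qform Q' u != 0.
  have [u Qu] := nondegenerate_qform_neq0 Q_nondeg.
  by exists (invmx N^T *m u); rewrite qform_mulmx mulKVmx // unitmx_tr.
move: D_inf; rewrite DE (ell_inf_line A_unit A_inf) mem_extended_dual_conic
  ?inf_coords_neq0 //.
move=> /eqP Q'w; have Q'dual : qform (map_mx iota Q') (tau_dual iota tau) = 0.
  have -> : tau_dual iota tau = ((tau - sg tau) * (tau - sg (sg tau)))^-1 *:
    map_mx sg inf_coords.
    congr (_ *: _); apply/colP => -[[|[|[|i]]] lti] //; rewrite !mxE /=.
    - by rewrite frobM.
    - by rewrite rmorphB rmorphN.
    by rewrite rmorph1.
  by rewrite qformZ -(map_frob_iota iota Q') qform_map Q'w rmorph0 mulr0.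
have [be beE] := special_qform_trace cardL tau_prim Q'dual.
have be0 : sg be != 0.
  rewrite fmorph_eq0; apply: contraNneq Q'u => be0.
  by rewrite -(fmorph_eq0 iota) beE be0 mul0r /trace3 !rmorph0 !addr0.
have [e [f [ef efE]]] := trace_F_line iota cardL tau_prim be0.
by exists e, f; split=> //; apply: trace_conic_subline efE.
Qed.

(** A collineation fixing the points of the subplane acts on line coordinates
    by a field automorphism fixing F. *)
Lemma conjugate_inf_coords m : conjugate_line pi (ell_inf L) m ->
  exists sigma : {rmorphism L -> L}, (forall a, sigma (iota a) = iota a) /\
    m = homography A (line_with_coords (map_mx sigma inf_coords)).
Proof.
case=> sigma [M [uM fixP _ ->]].
have [c [c0 ME sigma_iota]] := subplane_pointwise_fixed uM A_unit fixP.
exists sigma; split=> //; rewrite (ell_inf_line A_unit A_inf).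
have [sigma' _ sigmaK] := inj_card_bij (fmorph_inj sigma) (leqnn _).
apply/vspaceP => y; apply/idP/idP.
  case/mem_collineation => _ /memv_homography[x + ->] ->.
  rewrite map_mxM mulmxA ME -scalemxAl scalemxAr mem_homography_mul //.
  rewrite !mem_line_with_coords dotZr dot_map mulf_eq0 (negPf c0) fmorph_eq0.
  by [].
case/memv_homography => x wx ->; apply/mem_collineation.
have xE : x = c *: map_mx sigma (map_mx sigma' (c^-1 *: x)).
  apply/colP => i; rewrite !mxE sigmaK mulrA divff ?mul1r //.
exists (A *m map_mx sigma' (c^-1 *: x)); last first.
  by rewrite map_mxM mulmxA ME -scalemxAl scalemxAr -xE.
rewrite mem_homography_mul // mem_line_with_coords -(fmorph_eq0 sigma) -dot_map.
move: wx; rewrite mem_line_with_coords {1}xE dotZr mulf_eq0 (negPf c0).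
by [].
Qed.

Lemma F_line_dual_conic_subline e f : indep e f ->
  dual_conic_subline iota pi [set inf_pt s^-1 | s in F_line e f].
Proof.
move=> ef; have [g g0 gE] := F_line_trace cardL tau_prim ef.
pose be := sg (sg g); have sgbe : sg be = g by rewrite /be frob3.
have be0 : be != 0 by rewrite !fmorph_eq0.
pose Q := special_qform iota tau be.
have Qw : qform (map_mx iota Q) inf_coords = 0.
  rewrite special_qformE // dot_inf_coords_tau dot_inf_coords_conj; ring.
exists (extended_dual_conic iota A Q); last first.
  apply/esym; apply: (trace_conic_subline (Q := Q) (be := be)) => [u|x].
    exact: special_qform_cubic.
  by rewrite sgbe.
exists A, Q; split=> //.
- exact: (special_qform_nondegenerate cardL tau_prim).
- by rewrite (ell_inf_line A_unit A_inf) mem_extended_dual_conic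
    ?inf_coords_neq0 // Qw.
move=> m /conjugate_inf_coords[sigma [sigma_iota ->]].
have sigmaQ : map_mx sigma (map_mx iota Q) = map_mx iota Q.
  by apply/matrixP => i j; rewrite !mxE sigma_iota.
rewrite mem_extended_dual_conic ?map_mx_eq0 ?inf_coords_neq0 //.
by rewrite -sigmaQ qform_map Qw rmorph0.
Qed.

Lemma dual_conic_sublineP b : dual_conic_subline iota pi b <->
  exists e f, indep e f /\ b = [set inf_pt s^-1 | s in F_line e f].
Proof.
split=> [/dual_conic_subline_F_line|[e [f [ef ->]]]] //.
exact: F_line_dual_conic_subline.
Qed.

End DualConicSublines.

(** * The Bruck-Bose map *)

Lemma mx3_col3 (L : finFieldType) (a b c d e f g h i x y z : L) :
  mx3 [:: [:: a; b; c]; [:: d; e; f]; [:: g; h; i]] *m col3 x y z =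
  col3 (a * x + b * y + c * z) (d * x + e * y + f * z) (g * x + h * y + i * z).
Proof.
apply/colP => -[[|[|[|j]]] ltj] //;
  by rewrite !mxE !big_ord_recl big_ord0 !mxE /= addr0 addrA.
Qed.

Lemma unitmx_of_ker (K : fieldType) (n : nat) (A : 'M[K]_n) :
  (forall x : 'cV_n, A *m x = 0 -> x = 0) -> A \in unitmx.
Proof.
move=> A_inj; rewrite -unitmx_tr -row_free_unit; apply: inj_row_free => v vA0.
apply: trmx_inj; rewrite trmx0; apply: A_inj.
by rewrite -[A]trmxK -trmx_mul vA0 trmx0.
Qed.

Section BruckBoseMap.
Variables (F L : finFieldType) (iota : {rmorphism F -> L}).
Hypothesis cardL : #|L| = (#|F| ^ 3)%N.
Variables (tau : L) (tau_prim : (#|L|.-1).-primitive_root tau).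
Local Notation sg := (frob iota).
Local Notation bb := (bb iota tau).
Local Notation field_reduction := (field_reduction iota (Sigma_inf F)).

Lemma coords_lin a x y :
  coords iota tau (iota a * x + y) = a *: coords iota tau x + coords iota tau y.
Proof.
apply: (cubic_elt_inj cardL tau_prim (iota := iota)).
rewrite -[coords iota tau y]scale1r cubic_elt_comb !cubic_elt_coords //.
by rewrite rmorph1 mul1r.
Qed.

Lemma coords_eq0 x : coords iota tau x = 0 -> x = 0.
Proof.
move=> x0; apply/eqP; rewrite -(cubic_elt_coords iota cardL tau_prim x) x0.
by rewrite (cubic_elt_eq0 iota cardL tau_prim).
Qed.

Lemma bb_field_reduction : field_reduction bb.
Proof.
split=> [a x y x' y'|x y|x y].
- have stackD (u v u' v' : 'cV[F]_3) :
      col_mx (col_mx (a *: u + u') (a *: v + v')) (0 : 'cV_1) =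
      a *: col_mx (col_mx u v) 0 + col_mx (col_mx u' v') 0.
    by rewrite !scale_col_mx !add_col_mx scaler0 addr0.
  by rewrite /bb !coords_lin; apply: stackD.
- have stack0 (u v : 'cV[F]_3) :
      col_mx (col_mx u v) (0 : 'cV_1) = 0 -> u = 0 /\ v = 0.
    move/(congr1 usubmx); rewrite col_mxKu linear0 => uv0.
    by split; [rewrite -(col_mxKu u v) | rewrite -(col_mxKd u v)];
      rewrite uv0 linear0.
  by case/stack0 => /coords_eq0-> /coords_eq0->.
have stack_last (u : 'cV[F]_(3 + 3)) : col_mx u (0 : 'cV_1)
  (rshift (3 + 3) ord0) 0 = 0.
  by rewrite col_mxEd mxE.
rewrite mem_infinity /bb; have -> : ord_max = rshift 6 (ord0 : 'I_1)
  by apply: val_inj.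
exact/eqP/stack_last.
Qed.

Section Frame.
Variables a b c d e f : L.
Let phi := mx3 [:: [:: a; b; e]; [:: c; d; f]; [:: 0; 0; 1]].
Hypothesis phi_unit : phi \in unitmx.

Definition bb_map x y := bb (a * x + b * y) (c * x + d * y).

Lemma bb_map_field_reduction : field_reduction bb_map.
Proof.
have [lin inj inS] := bb_field_reduction; split=> [r x y x' y'|x y|x y].
- by rewrite -lin /bb_map; congr (bb _ _); ring.
- case/inj => e1 e2; have : phi *m col3 x y 0 = phi *m 0.
    by rewrite mx3_col3 mulmx0 !mulr0 !mul0r !addr0 e1 e2; apply/eqP;
      rewrite col3_eq0 !eqxx.
  by move/(unitmx_mul_inj phi_unit)/eqP;
    rewrite col3_eq0 => /and3P[/eqP-> /eqP->].
exact: inS.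
Qed.

Lemma Kmx_col3 x y z : Kmx F tau *m col3 x y z =
  col3 (y - tau * x) (y - sg tau * x) (dot (inf_coords iota tau) (col3 x y z)).
Proof. by rewrite mx3_col3 dot_col3 /frob; congr col3; ring. Qed.

Lemma Kmx_unit : Kmx F tau \in unitmx.
Proof.
have [d1 _ _] := tau_diffs iota cardL tau_prim.
apply: unitmx_of_ker => v; rewrite (col3E v);
  move: (v 0 0) (v 1 0) (v (1 + 1) 0) => x y z.
rewrite Kmx_col3 dot_col3 => /eqP;
  rewrite col3_eq0 => /and3P[/eqP e1 /eqP e2 /eqP e3].
have x0 : x = 0.
  by apply: (mulfI d1); rewrite mulr0 -{1}(subrr 0) -{1}e2 -e1; ring.
have y0 : y = 0 by rewrite -e1 x0; ring.
have z0 : z = 0 by rewrite -e3 x0 y0; ring.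
by apply/eqP; rewrite x0 y0 z0 col3_eq0 !eqxx.
Qed.

Let A := phi *m Kmx F tau.

Lemma frame_unit : A \in unitmx.
Proof. by rewrite unitmx_mul phi_unit Kmx_unit. Qed.

Lemma frame_inf x : (A *m x \in ell_inf L) = (dot (inf_coords iota tau) x == 0).
Proof.
rewrite -mulmxA (col3E x) Kmx_col3 mx3_col3 mem_infinity.
have -> : (ord_max : 'I_3) = 1 + 1 by apply: val_inj.
by rewrite [in LHS]mxE /= !mul0r !add0r mul1r.
Qed.

Lemma frame_subplane :
  [set homography phi P | P in subplaneB iota tau] = subplane_of iota A.
Proof.
rewrite /subplaneB /subplane_of -imset_comp; apply: eq_imset => P /=.
by rewrite homography_mul.
Qed.

Lemma bb_plane_inf_pt s :
  bb_plane iota tau (inf_pt iota tau A s) = spread_plane iota bb_map s.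
Proof.
have [d1 _ _] := tau_diffs iota cardL tau_prim.
have [lin inj _] := bb_field_reduction.
have bb0 : bb 0 0 = 0 := field_reduction0 bb_field_reduction.
have ptE : inf_pt iota tau A s = <[col3 (a * s + b * sg s) (c * s + d * sg s)
  0]>%VS.
  rewrite /inf_pt; have -> : A *m inf_vec iota tau s =
      (tau - sg tau) *: col3 (a * s + b * sg s) (c * s + d * sg s) 0.
    rewrite -mulmxA; have := inf_coords_inf_vec iota tau s.
    rewrite /inf_vec map_tau_pt; set v := (_ - _); rewrite (col3E v) => wv.
    rewrite Kmx_col3 wv mx3_col3 !mxE /=.
    by apply/colP => -[[|[|[|i]]] lti] //; rewrite !mxE /=; ring.
  by rewrite vline_scale.
rewrite ptE; apply/vspaceP => y; rewrite /bb_plane.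
have memP := @mem_span_image _ _ _ <[col3 (a * s + b * sg s) (c * s + d * sg s)
  0]>%VS
  (fun v : 'cV[L]_3 => bb (v 0 0) (v 1 0)).
apply/idP/idP => [/memP [||v]|/(spread_planeP bb_map_field_reduction)[x ->]].
- by exists 0; rewrite ?mem0v // !mxE.
- move=> r v v' Av Av'; exists (iota r *: v + v');
    first by rewrite rpredD ?rpredZ.
  by rewrite !mxE lin.
- case/vlineP => x -> ->; apply/(spread_planeP bb_map_field_reduction).
  exists x; rewrite /bb_map !mxE /=.
  by congr (bb _ _); ring.
apply/memP.
- by exists 0; rewrite ?mem0v // !mxE.
- move=> r v v' Av Av'; exists (iota r *: v + v');
    first by rewrite rpredD ?rpredZ.
  by rewrite !mxE lin.
exists (x *: col3 (a * s + b * sg s) (c * s + d * sg s) 0).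
  by rewrite memvZ ?memv_line.
by rewrite /bb_map !mxE /=; congr (bb _ _); ring.
Qed.

Lemma iter_frob r x : iter r sg x = x ^+ (#|F| ^ r).
Proof. by elim: r => [|r IH] //=; rewrite IH /frob -exprM expnSr. Qed.

Lemma induced_cover_plane r k :
  induced_map iota tau a b c d (cover_plane iota tau r k) = cover_of iota bb_map
    r k.
Proof.
have [lin _ _] := bb_field_reduction.
have coverE v : bb v.1 v.2 \in cover_plane iota tau r k <->
    exists x, v = (k * x, iter r sg x).
  have -> : cover_plane iota tau r k = cover_of iota bb r k.
    by congr <<_>>%VS; apply: eq_map => x; rewrite iter_frob.
  rewrite (cover_ofP bb_field_reduction); split=> [[x]|[x ->]];
    last by exists x.
  by case: v => v1 v2 /= /(field_reduction_inj bb_field_reduction)[-> ->];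
    exists x.
apply/vspaceP => y; rewrite /induced_map.
have memP := @mem_span_image _ _ _ [pred v : L * L | bb v.1 v.2 \in cover_plane
  iota tau r k]
  (fun v => bb_map v.1 v.2).
have [linJ _ _] := bb_map_field_reduction.
have c0 : exists2 v, v \in [pred v : L * L | bb v.1 v.2 \in cover_plane iota tau
  r k] & bb_map v.1 v.2 = 0.
  exists (0, 0); last exact: field_reduction0 bb_map_field_reduction.
  by rewrite inE /= (field_reduction0 bb_field_reduction) mem0v.
apply/idP/idP => [/(memP c0) [|v]|/(cover_ofP bb_map_field_reduction)[x ->]].
- move=> t v v' Av Av'; exists (iota t * v.1 + v'.1, iota t * v.2 + v'.2) =>
    //=.
  by rewrite inE /= lin memvD ?memvZ.
- rewrite inE => /coverE[x -> ->].
  by apply/(cover_ofP bb_map_field_reduction); exists x.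
apply/(memP c0).
  move=> t v v' Av Av'; exists (iota t * v.1 + v'.1, iota t * v.2 + v'.2) =>
    //=.
  by rewrite inE /= lin memvD ?memvZ.
by exists (k * x, iter r sg x) => //; rewrite inE; apply/coverE; exists x.
Qed.

End Frame.

(** The homography phi enters only through the frame phi K of the subplane and
    the map bb_map: in this frame the covers and the planes of the splash have
    the same equations as those of the reference subplane. *)
Lemma transported_cover_frame r pi C :
  is_transported_cover iota tau [set cover_plane iota tau r k | k in norm1 F L]
    pi C ->
  exists A J, [/\ A \in unitmx /\
      (forall x, (A *m x \in ell_inf L) = (dot (inf_coords iota tau) x == 0)),
    pi = subplane_of iota A, field_reduction J,
    (forall s, bb_plane iota tau (inf_pt iota tau A s) = spread_plane iota J s)
      &
    C = cover iota J r].
Proof.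
case=> a [b [c [d [e [f [phi_unit <- ->]]]]]].
set phi := mx3 _ in phi_unit *; exists (phi *m Kmx F tau), (bb_map a b c d);
  split.
- by split; [apply: frame_unit | apply: frame_inf].
- exact: frame_subplane.
- exact: bb_map_field_reduction phi_unit.
- exact: bb_plane_inf_pt.
rewrite -imset_comp; apply: eq_imset => k /=;
  exact: (induced_cover_plane phi_unit).
Qed.

End BruckBoseMap.

(** * The two families of sublines and the two covers *)

Section Families.
Variables (F L : finFieldType) (iota : {rmorphism F -> L}).
Hypothesis cardL : #|L| = (#|F| ^ 3)%N.
Variables (tau : L) (tau_prim : (#|L|.-1).-primitive_root tau).
Local Notation bb_image := (bb_image iota tau).
Local Notation splash_planes := (splash_planes iota tau).
Local Notation indep := (indep iota).
Local Notation F_line := (F_line iota).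
Local Notation spread_planes := (spread_planes iota).

(** The assertions about pencils, for any family of sublines that a field
    reduction turns into the pencils. Swapping the coordinates turns the dual
    conic sublines into such a family, and exchanges the covers. *)
Lemma family_meets_covers (J : L -> L -> 'cV[F]_7) (pi : {set subspace L 3})
    (pt : L -> subspace L 3) (family : {set subspace L 3} -> Prop) :
  field_reduction iota (Sigma_inf F) J ->
  (forall s, s != 0 -> bb_plane iota tau (pt s) = spread_plane iota J s) ->
  splash pi = [set pt s | s : L & s != 0] ->
  (forall b, family b <-> exists e f, indep e f /\ b =
    [set pt s | s in F_line e f]) ->
  [/\ forall b, family b -> is_2regulus (Sigma_inf F) (bb_image b) /\
        meets_each_in_a_distinct_line (bb_image b) (cover iota J 1),
      forall R, is_2regulus (Sigma_inf F) R -> R \subset splash_planes pi ->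
        (exists2 X, X \in cover iota J 1 & meets_in_a_line R X) ->
        exists2 b, family b & R = bb_image b,
      forall b, family b -> is_2regulus (Sigma_inf F) (bb_image b) /\
        meets_each_in_a_conic (bb_image b) (cover iota J 2) &
      (2 < #|F|)%N ->
      forall R, is_2regulus (Sigma_inf F) R -> R \subset splash_planes pi ->
        (exists2 X, X \in cover iota J 2 & meets_in_a_conic R X) ->
        exists2 b, family b & R = bb_image b].
Proof.
move=> J_red ptE splashE familyE.
have imageE (Z : {set L}) : (forall s, s \in Z -> s != 0) ->
    bb_image [set pt s | s in Z] = spread_planes J Z.
  by move=> Z0; rewrite /bb_image -imset_comp; apply: eq_in_imset => s /Z0/ptE.
have lineE e f := imageE (F_line e f) (@F_line_neq0 _ _ iota e f).
have subE (R : {set subspace F 7}) : R \subset splash_planes pi ->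
    exists2 Z : {set L}, forall s, s \in Z -> s != 0 & R = spread_planes J Z.
  rewrite /splash_planes splashE.
  have -> : [set pt s | s : L & s != 0] =
    [set pt s | s in [set s : L | s != 0]].
    by apply: eq_imset.
  rewrite imageE; last by move=> s; rewrite inE.
  move/subsetP => R_sub.
  exists [set s | (s != 0) && (spread_plane iota J s \in R)].
    by move=> s; rewrite inE => /andP[].
  apply/setP => Y; apply/idP/imsetP => [YR|[s + ->]]; last by rewrite inE =>
    /andP[].
  have /imsetP[s] := R_sub _ YR; rewrite inE => s0 YE.
  by exists s; rewrite // inE s0 -YE.
have of_pencil (R : {set subspace F 7}) : (exists e f, indep e f /\ R =
  spread_planes J (F_line e f)) ->
    exists2 b, family b & R = bb_image b.
  case=> e [f [ef ->]]; exists [set pt s | s in F_line e f];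
    last by rewrite lineE.
  by apply/familyE; exists e, f.
split=> [b /familyE[e [f [ef ->]]]|R R_reg /subE[Z Z0 RE] [X XT X_line]
        |b /familyE[e [f [ef ->]]]|q_gt2 R R_reg /subE[Z Z0 RE] [X XC X_conic]].
- rewrite lineE; have [reg line distinct _] := pencil_meets_covers cardL
    tau_prim J_red ef.
  by split.
- rewrite RE in X_line *; apply: of_pencil.
  exact: (line_section_is_pencil cardL tau_prim J_red Z0 XT X_line).
- rewrite lineE; have [reg _ _ conic] := pencil_meets_covers cardL tau_prim
    J_red ef.
  by split.
rewrite RE in R_reg X_conic *; apply: of_pencil.
exact: (conic_section_is_pencil cardL tau_prim J_red Z0 R_reg q_gt2 XC X_conic).
Qed.

Section TransportedCover.
Variables (pi : {set subspace L 3}) (A : 'M[L]_3) (J : L -> L -> 'cV[F]_7).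
Hypotheses (A_unit : A \in unitmx)
  (A_inf : forall x, (A *m x \in ell_inf L) = (dot (inf_coords iota tau) x ==
    0))
  (piE : pi = subplane_of iota A) (J_red : field_reduction iota (Sigma_inf F) J)
  (ptE : forall s, bb_plane iota tau (inf_pt iota tau A s) = spread_plane iota J
    s).

Lemma pencils_meet_covers :
  [/\ forall b, pencil_subline pi b -> is_2regulus (Sigma_inf F) (bb_image b) /\
        meets_each_in_a_distinct_line (bb_image b) (cover iota J 1),
      forall R, is_2regulus (Sigma_inf F) R -> R \subset splash_planes pi ->
        (exists2 X, X \in cover iota J 1 & meets_in_a_line R X) ->
        exists2 b, pencil_subline pi b & R = bb_image b,
      forall b, pencil_subline pi b -> is_2regulus (Sigma_inf F) (bb_image b) /\
        meets_each_in_a_conic (bb_image b) (cover iota J 2) &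
      (2 < #|F|)%N ->
      forall R, is_2regulus (Sigma_inf F) R -> R \subset splash_planes pi ->
        (exists2 X, X \in cover iota J 2 & meets_in_a_conic R X) ->
        exists2 b, pencil_subline pi b & R = bb_image b].
Proof.
apply: (family_meets_covers (pt := inf_pt iota tau A)) => //.
  by rewrite piE (splash_subplane cardL tau_prim A_unit A_inf).
by move=> b; rewrite piE; apply: (pencil_sublineP cardL tau_prim A_unit A_inf).
Qed.

Lemma dual_conics_meet_covers :
  [/\ forall b, dual_conic_subline iota pi b -> is_2regulus (Sigma_inf F)
    (bb_image b) /\
        meets_each_in_a_distinct_line (bb_image b) (cover iota J 2),
      forall R, is_2regulus (Sigma_inf F) R -> R \subset splash_planes pi ->
        (exists2 X, X \in cover iota J 2 & meets_in_a_line R X) ->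
        exists2 b, dual_conic_subline iota pi b & R = bb_image b,
      forall b, dual_conic_subline iota pi b -> is_2regulus (Sigma_inf F)
        (bb_image b) /\
        meets_each_in_a_conic (bb_image b) (cover iota J 1) &
      (2 < #|F|)%N ->
      forall R, is_2regulus (Sigma_inf F) R -> R \subset splash_planes pi ->
        (exists2 X, X \in cover iota J 1 & meets_in_a_conic R X) ->
        exists2 b, dual_conic_subline iota pi b & R = bb_image b].
Proof.
rewrite -(cover_swap1 cardL J_red) -(cover_swap2 cardL J_red).
apply: (family_meets_covers (pt := fun s => inf_pt iota tau A s^-1)).
- exact: swap_field_reduction.
- by move=> s s0; rewrite ptE (spread_plane_swap J_red).
- rewrite piE (splash_subplane cardL tau_prim A_unit A_inf).
  apply/setP => P; apply/imsetP/imsetP => -[s]; rewrite inE => s0 ->.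
    by exists s^-1; rewrite ?inE ?invr_eq0 ?invrK.
  by exists s^-1; rewrite ?inE ?invr_eq0.
by move=> b; rewrite piE; apply: (dual_conic_sublineP cardL tau_prim A_unit
  A_inf).
Qed.

End TransportedCover.
End Families.

(* For q = 2 any three planes of the spread form a 2-regulus, so that the
   splash contains 35 of them, and not only the 2(q^2+q+1) = 14 that come from
   the two families of sublines: the converses about conics fail then. *)
Theorem theorem7p2 (F L : finFieldType) (iota : {rmorphism F -> L}) (tau : L)
    (cardL : #|L| = (#|F| ^ 3)%N)
    (primitive_tau : (#|L|.-1).-primitive_root tau)
    (pi : {set subspace L 3}) (TT CC : {set subspace F 7})
    (subplane_pi : is_subplane iota pi) (exterior_pi : exterior pi)
    (tangent_TT : is_tangent_cover iota tau pi TT)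
    (conic_CC : is_conic_cover iota tau pi CC) :
  [/\ (forall b, pencil_subline pi b ->
         is_2regulus (Sigma_inf F) (bb_image iota tau b) /\
         meets_each_in_a_distinct_line (bb_image iota tau b) TT) /\
      (forall R, is_2regulus (Sigma_inf F) R ->
         R \subset splash_planes iota tau pi ->
         (exists2 X, X \in TT & meets_in_a_line R X) ->
         exists2 b, pencil_subline pi b & R = bb_image iota tau b),
      (forall b, pencil_subline pi b ->
         is_2regulus (Sigma_inf F) (bb_image iota tau b) /\
         meets_each_in_a_conic (bb_image iota tau b) CC) /\
      ((2 < #|F|)%N ->
       forall R, is_2regulus (Sigma_inf F) R ->
         R \subset splash_planes iota tau pi ->
         (exists2 X, X \in CC & meets_in_a_conic R X) ->
         exists2 b, pencil_subline pi b & R = bb_image iota tau b),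
      (forall b, dual_conic_subline iota pi b ->
         is_2regulus (Sigma_inf F) (bb_image iota tau b) /\
         meets_each_in_a_conic (bb_image iota tau b) TT) /\
      ((2 < #|F|)%N ->
       forall R, is_2regulus (Sigma_inf F) R ->
         R \subset splash_planes iota tau pi ->
         (exists2 X, X \in TT & meets_in_a_conic R X) ->
         exists2 b, dual_conic_subline iota pi b & R = bb_image iota tau b) &
      (forall b, dual_conic_subline iota pi b ->
         is_2regulus (Sigma_inf F) (bb_image iota tau b) /\
         meets_each_in_a_distinct_line (bb_image iota tau b) CC) /\
      (forall R, is_2regulus (Sigma_inf F) R ->
         R \subset splash_planes iota tau pi ->
         (exists2 X, X \in CC & meets_in_a_line R X) ->
         exists2 b, dual_conic_subline iota pi b & R = bb_image iota tau b)].
Proof.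
have [A [J [[A_unit A_inf] piE J_red ptE ->]]] :=
  transported_cover_frame cardL primitive_tau tangent_TT.
have [A' [J' [[A'_unit A'_inf] piE' J'_red ptE' ->]]] :=
  transported_cover_frame cardL primitive_tau conic_CC.
(* The covers may be named by different homographies, hence the two frames. *)
have [pencil_T line_T _ _] :=
  pencils_meet_covers cardL primitive_tau A_unit A_inf piE J_red ptE.
have [_ _ dual_T conic_T] :=
  dual_conics_meet_covers cardL primitive_tau A_unit A_inf piE J_red ptE.
have [_ _ pencil_C conic_C] :=
  pencils_meet_covers cardL primitive_tau A'_unit A'_inf piE' J'_red ptE'.
have [dual_C line_C _ _] :=
  dual_conics_meet_covers cardL primitive_tau A'_unit A'_inf piE' J'_red ptE'.
by split; split.
Qed.
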